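(* Let $G$ be a graph on $\{1,\dots,n\}$ and let $\mathbf c$ be a relative interior regular class critical point of a fixed hull and contact class $X=\mathcal F\cap\mathcal C(G)$. Let $\widetilde{\operatorname{Per}}$ be the local smooth extension of $\operatorname{Per}$ obtained by fixing the hull cycle, and let $\lambda=(\lambda_{ij})_{\{i,j\}\in E(G)}$ be the multiplier vector satisfying $$\nabla\widetilde{\operatorname{Per}}(\mathbf c)=\sum_{\{i,j\}\in E(G)}\lambda_{ij}\nabla h_{ij}(\mathbf c),\qquad h_{ij}(\mathbf d)=\|\mathbf d_j-\mathbf d_i\|-2.$$ Then for every $\delta\mathbf c\in T_{\mathbf c}X=\mathbf{Roll}(\mathbf c)$ and every $C^2$ curve $\mathbf c(t)\subset X$ with $\mathbf c(0)=\mathbf c$ and $\dot{\mathbf c}(0)=\delta\mathbf c$, one has $$\left.\frac{d^2}{dt^2}\right|_{t=0}\operatorname{Per}(\mathbf c(t))=D^2\widetilde{\operatorname{Per}}(\mathbf c)[\delta\mathbf c,\delta\mathbf c]-\sum_{\{i,j\}\in E(G)}\lambda_{ij}D^2h_{ij}(\mathbf c)[\delta\mathbf c,\delta\mathbf c].$$ Moreover, such a $C^2$ curve exists for every $\delta\mathbf c\in\mathbf{Roll}(\mathbf c)$.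
   Context: $\mathcal D_n=\{\mathbf c\in(\mathbb R^2)^n:\|\mathbf c_i-\mathbf c_j\|\ge2\ \forall i\ne j\}$. For $\mathbf c\in\mathcal D_n$, $P(\mathbf c)=\operatorname{conv}\{\mathbf c_1,\dots,\mathbf c_n\}$ is the centre hull and $\operatorname{Per}(\mathbf c)$ is the length of the boundary of the convex hull of the union of the closed unit disks centred at $\mathbf c_1,\dots,\mathbf c_n$ (equal to $\operatorname{Per}(P(\mathbf c))+2\pi$). For a graph $G$ on $\{1,\dots,n\}$ with edge set $E(G)$: $\mathcal C(G)$ is the set of $\mathbf c\in\mathcal D_n$ with $\|\mathbf c_i-\mathbf c_j\|=2$ exactly for $\{i,j\}\in E(G)$ (and $>2$ for non-edges); $M(G)=\{\mathbf d\in(\mathbb R^2)^n:\|\mathbf d_i-\mathbf d_j\|=2\ \forall\{i,j\}\in E(G)\}$; $\mathbf d\in M(G)$ is regular for $G$ if the gradients at $\mathbf d$ of $g_{ij}(\mathbf d)=\|\mathbf d_j-\mathbf d_i\|^2-4$, $\{i,j\}\in E(G)$, are linearly independent. $\mathbf c$ is hull stable if all configurations of $\mathcal D_n$ in some neighbourhood of $\mathbf c$ have a centre hull with the same set of hull vertex indices and the same cyclic order as $P(\mathbf c)$. For hull stable $\mathbf c\in\mathcal C(G)$ regular for $G$, let $\mathcal F$ be the set of configurations whose centre hull has the same hull vertex set and cyclic order as $P(\mathbf c)$, and let $\mathcal B$ be the list of oriented hull edges in cyclic order. A fixed hull and contact class is a set $X=\mathcal F\cap\mathcal C(G)$ of this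 form. A point $\mathbf c\in X$ is a relative interior regular point if it is regular for $G$ and there is an open neighbourhood $U_0$ of $\mathbf c$ in $(\mathbb R^2)^n$ with $\|\mathbf d_i-\mathbf d_j\|>2$ for all $\mathbf d\in U_0\cap M(G)$ and all $\{i,j\}\notin E(G)$, and $U_0\cap\mathcal D_n\subset\mathcal F$ (so that $X\cap U_0=M(G)\cap U_0$, which near $\mathbf c$ is a smooth submanifold with tangent space $T_{\mathbf c}X=\mathbf{Roll}(\mathbf c)$). $\widetilde{\operatorname{Per}}(\mathbf d)=\sum_{(p,q)\in\mathcal B}\|\mathbf d_q-\mathbf d_p\|+2\pi$, which is smooth near $\mathbf c$ and equals $\operatorname{Per}$ on $\mathcal F$; $D\operatorname{Per}(\mathbf c)$ denotes $D\widetilde{\operatorname{Per}}(\mathbf c)$. For $\{i,j\}\in E(G)$, $\mathbf u_{ij}=(\mathbf c_j-\mathbf c_i)/\|\mathbf c_j-\mathbf c_i\|$. The rolling space is $\mathbf{Roll}(\mathbf c)=\{\delta\mathbf c\in(\mathbb R^2)^n:\langle\mathbf u_{ij},\delta\mathbf c_j-\delta\mathbf c_i\rangle=0\ \forall\{i,j\}\in E(G)\}$. $\mathbf c$ is class critical if $D\operatorname{Per}(\mathbf c)[\eta]=0$ for every $\eta\in\mathbf{Roll}(\mathbf c)$; for a relative interior regular point this is equivalent to the existence of a multiplier vector $\lambda$ as in the statement. *)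

(* Defs.v *)
From HB Require Import structures.
From mathcomp Require Import all_boot all_order all_algebra.
From mathcomp Require Import all_classical all_reals all_analysis.

Set Implicit Arguments.
Unset Strict Implicit.
Unset Printing Implicit Defensive.
Import Order.TTheory GRing.Theory Num.Theory.
Import numFieldNormedType.Exports.
Local Open Scope classical_set_scope.
Local Open Scope ring_scope.

(* A configuration (R^2)^n is a matrix 'M[R]_(n, 2) whose i-th row is the i-th
   centre.  The library norm on matrices is the sup norm: it is only used for
   the topology and for differentiation; all distances are Euclidean. *)

Section Plane.
Context {R : realType}.
Implicit Types (x y z u v : 'rV[R]_2) (A : set 'rV[R]_2) (s : seq 'rV[R]_2).

Definition dot u v : R := \sum_(k < 2) u 0 k * v 0 k.

Definition enorm u : R := Num.sqrt (dot u u).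

(* Twice the signed area of the triangle x y z, positive iff x, y, z is a
   counterclockwise triple. *)
Definition orient x y z : R :=
  (y - x) 0 0 * (z - x) 0 1 - (y - x) 0 1 * (z - x) 0 0.

Definition conv_hull A : set 'rV[R]_2 := smallest (@convex_set R 'rV[R]_2) A.

Definition extreme_point A x : Prop :=
  A x /\ forall y z (t : R), A y -> A z -> 0 < t -> t < 1 ->
    x = t *: y + (1 - t) *: z -> y = z.

Definition frontier A : set 'rV[R]_2 := closure A `\` interior A.

(* The oriented edges of the closed polygon with successive vertices s,
   including the closing edge; a one-vertex polygon has one degenerate edge. *)
Definition cyclic_edges (T : Type) (s : seq T) : seq (T * T) := zip s (rot 1 s).

Definition polygon_length s : R :=
  \sum_(e <- cyclic_edges s) enorm (e.2 - e.1).

(* Strict inequality matters: with 0 <= orient, a list running back and forth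
   along a segment would qualify, and boundary_length below would be infinite. *)
Definition ccw_convex_polygon s : Prop :=
  forall i j k, (i < j)%N -> (j < k)%N -> (k < size s)%N ->
    0 < orient (nth 0 s i) (nth 0 s j) (nth 0 s k).

(* Length of the closed curve bounding a compact convex set K, as the supremum
   of the lengths of the polygons inscribed in it, i.e. whose vertices are
   points of the curve taken in cyclic order; since the curve is convex, the
   polygons so obtained are the convex ones with vertices on the curve. *)
Definition boundary_length (K : set 'rV[R]_2) : R :=
  sup [set l | exists s, [/\ forall x, x \in s -> frontier K x,
                             ccw_convex_polygon s & l = polygon_length s]].

End Plane.

Section Calculus.
Context {R : realType} {m n : nat}.
Implicit Types (f : 'M[R]_(m, n) -> R) (x u v : 'M[R]_(m, n)).

Definition gradient f x : 'M[R]_(m, n) := \matrix_(i, k) 'd f x (delta_mx i k).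

Definition D2 f x u v : R := 'd (fun y => 'd f y u : R) x v.

Definition C2_on (a b : R) (g : R -> 'M[R]_(m, n)) : Prop :=
  forall t, a < t -> t < b ->
    [/\ derivable g t 1, derivable (derive1 g) t 1 & {for t, continuous (derive1n 2 g)}].

End Calculus.

Section Configurations.
Context {R : realType} {n : nat}.
Implicit Types (c d : 'M[R]_(n, 2)) (E : rel 'I_n).

Definition dist c (i j : 'I_n) : R := enorm (row i c - row j c).

Definition packing c : Prop := forall i j : 'I_n, i != j -> 2 <= dist c i j.

Definition centre_hull c : set 'rV[R]_2 := conv_hull [set row i c | i in setT].

Definition disks c : set 'rV[R]_2 :=
  [set x | exists i : 'I_n, enorm (x - row i c) <= 1].

Definition Per c : R := boundary_length (conv_hull (disks c)).

Definition hull_vertex c (i : 'I_n) : Prop :=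
  extreme_point (centre_hull c) (row i c).

(* s lists the hull vertex indices in counterclockwise order along the boundary
   of the centre hull: each (p, q) in cyclic_edges s is a hull edge, traversed
   with all the centres on its left.  When the centre hull is a segment, its two
   orientations are the two oriented hull edges.  s is unique up to rotation. *)
Definition hull_cycle c (s : seq 'I_n) : Prop :=
  [/\ uniq s,
      forall i, i \in s <-> hull_vertex c i &
      forall p q, (p, q) \in cyclic_edges s ->
        forall k, 0 <= orient (row p c) (row q c) (row k c)].

Definition same_hull c d : Prop := exists s, hull_cycle c s /\ hull_cycle d s.

Definition hull_stable c : Prop :=
  packing c /\ \forall d \near c, packing d -> same_hull c d.

Definition hull_class c : set 'M[R]_(n, 2) :=
  [set d | packing d /\ same_hull c d].

(* E is the adjacency relation of a graph; each edge {i, j} is represented once,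
   by the pair (i, j) with i < j. *)
Definition edges E : {set 'I_n * 'I_n} :=
  [set p : 'I_n * 'I_n | (p.1 < p.2)%N && E p.1 p.2]%SET.

Definition contact_class E : set 'M[R]_(n, 2) :=
  [set c | packing c /\ forall i j, i != j -> (dist c i j = 2 <-> E i j)].

Definition linkage E : set 'M[R]_(n, 2) :=
  [set d | forall i j, E i j -> dist d i j = 2].

Definition contact_sq (p : 'I_n * 'I_n) d : R :=
  enorm (row p.2 d - row p.1 d) ^+ 2 - 4.

Definition contact (p : 'I_n * 'I_n) d : R :=
  enorm (row p.2 d - row p.1 d) - 2.

Definition regular E d : Prop :=
  linkage E d /\ free [seq gradient (contact_sq p) d | p <- enum (edges E)].

Definition fixed_class E c0 : set 'M[R]_(n, 2) :=
  hull_class c0 `&` contact_class E.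

Definition rel_interior_regular E c0 c : Prop :=
  [/\ fixed_class E c0 c, regular E c &
      exists U0 : set 'M[R]_(n, 2),
        [/\ open U0, U0 c,
            forall d, U0 d -> linkage E d ->
              forall i j, i != j -> ~~ E i j -> 2 < dist d i j &
            forall d, U0 d -> packing d -> hull_class c0 d]].

Definition Per_ext (s : seq 'I_n) d : R :=
  \sum_(e <- cyclic_edges s) enorm (row e.2 d - row e.1 d) + 2 * pi.

Definition unit_dir c (i j : 'I_n) : 'rV[R]_2 :=
  (enorm (row j c - row i c))^-1 *: (row j c - row i c).

Definition Roll E c : set 'M[R]_(n, 2) :=
  [set v | forall i j, E i j -> dot (unit_dir c i j) (row j v - row i v) = 0].

Definition class_critical E (s : seq 'I_n) c : Prop :=
  forall v, Roll E c v -> 'd (Per_ext s) c v = 0.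

Definition C2_curve_through (X : set 'M[R]_(n, 2)) c (v : 'M[R]_(n, 2))
    (eps : R) (gam : R -> 'M[R]_(n, 2)) : Prop :=
  [/\ 0 < eps, C2_on (- eps) eps gam,
      forall t, - eps < t -> t < eps -> X (gam t),
      gam 0 = c & derive1 gam 0 = v].

End Configurations.

(* Main.v *)
Require Import Defs.
From HB Require Import structures.
From mathcomp Require Import all_boot all_order all_algebra.
From mathcomp Require Import all_classical all_reals all_analysis.
From mathcomp Require Import ring lra zify.
Set Implicit Arguments.
Unset Strict Implicit.
Unset Printing Implicit Defensive.
Import Order.TTheory GRing.Theory Num.Theory.
Import numFieldNormedType.Exports.
Local Open Scope classical_set_scope.
Local Open Scope ring_scope.

(* The perimeter of the hull of the disks is the length of the hull polygon plus
   2 pi: by Cauchy-Crofton lengths of closed convex polygons are averages of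
   their widths over all directions, and the width of the hull of the disks
   exceeds that of the centre hull by 2.  So on the class Per is the smooth
   function Per_ext (up to a constant).  Along a C2 curve in the class, the second
   derivative of Per_ext is D2 Per_ext [v, v] + D Per_ext [a] with a the
   acceleration, and likewise 0 = D2 h [v, v] + D h [a] for every contact h; the
   multiplier equation eliminates a.  A curve with given velocity is obtained as
   a power series: the constraints are quadratic, regularity lets one solve for
   the coefficients recursively, and they grow at most geometrically. *)

(** * Closed polygons *)

(** Since [boundary_length] is a supremum over inscribed polygons, the perimeter formula needs two
    bounds. Both compare, direction by direction, the variation of a linear form along closed
    polygons: a closed path through two points varies at least twice their difference, and a convex
    polygon at most twice its width. Averages over directions appear only as increments of
    antiderivatives, compared by the mean value theorem. For the lower bound the inscribed polygon
    has the vertices [row (p k) d + u k], where [p k] is a farthest centre in the direction [u k],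
    for equally spaced [u k]. Adding the unit vector makes each vertex the strict maximum of its own
    direction, which gives the strict convexity demanded by [ccw_convex_polygon] even when many
    directions share one centre. The recursion for the curve solves for the coefficients above the
    base point, so that it becomes a pure convolution and a majorant applies. The curve so obtained
    is only known to lie in the linkage; the neighbourhood attached to a relative interior regular
    point carries it into the class. *)

Section ClosedPaths.
Context {R : realType} {T : Type}.
Implicit Types (f : T -> R) (x : T) (s p q : seq T).

Definition steps x q : seq (T * T) := zip (belast x q) q.

Definition path_variation f x q : R := \sum_(e <- steps x q) `|f e.2 - f e.1|.

(** For a linear form [f] given by a unit vector, this is the length, with multiplicity, of the
    projection of the closed polygon: the quantity that Cauchy-Crofton averages. *)
Definition cyclic_variation f s : R := \sum_(e <- cyclic_edges s) `|f e.2 - f e.1|.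

Lemma cyclic_edges_cons x p : cyclic_edges (x :: p) = steps x (rcons p x).
Proof. by rewrite /cyclic_edges rot1_cons /steps belast_rcons. Qed.

Lemma cyclic_edges_map (T' : Type) (h : T -> T') s :
  cyclic_edges (map h s) = [seq (h e.1, h e.2) | e <- cyclic_edges s].
Proof.
rewrite /cyclic_edges -map_rot.
by elim: s (rot 1 s) => [|x s IHs] [|y t]//=; rewrite IHs.
Qed.

Lemma path_variation_cons f x y q :
  path_variation f x (y :: q) = `|f y - f x| + path_variation f y q.
Proof. by rewrite /path_variation /steps /= big_cons. Qed.

Lemma path_variation_cat f x p q :
  path_variation f x (p ++ q) =
  path_variation f x p + path_variation f (last x p) q.
Proof.
elim: p x => [|y p IHp] x; first by rewrite /path_variation /steps big_nil add0r.
by rewrite cat_cons !path_variation_cons IHp addrA.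
Qed.

Lemma path_variation_ge f x q : `|f (last x q) - f x| <= path_variation f x q.
Proof.
elim: q x => [|y q IHq] x.
  by rewrite /path_variation /steps big_nil subrr normr0.
rewrite path_variation_cons /=.
have := ler_normD (f y - f x) (f (last y q) - f y).
by rewrite addrC subrKA => /le_trans; apply; rewrite lerD2l; exact: IHq.
Qed.

Lemma path_variation_nondecreasing f x q :
  path (fun a b => f a <= f b) x q -> path_variation f x q = f (last x q) - f x.
Proof.
elim: q x => [|y q IHq] x; first by rewrite /path_variation /steps big_nil subrr.
move=> /andP[xy yq]; rewrite path_variation_cons IHq// ger0_norm ?subr_ge0//=.
by rewrite addrC subrKA.
Qed.

Lemma path_variation_nonincreasing f x q :
  path (fun a b => f b <= f a) x q -> path_variation f x q = f x - f (last x q).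
Proof.
move=> xq; have -> : path_variation f x q = path_variation (fun a => - f a) x q.
  by apply: eq_bigr => e _; rewrite -opprD normrN.
rewrite path_variation_nondecreasing ?opprK 1?addrC//.
by under eq_path do rewrite lerN2.
Qed.


Lemma cyclic_variation_rot1 f s : cyclic_variation f (rot 1 s) = cyclic_variation f s.
Proof.
case: s => [|x [|y p]]//; rewrite rot1_cons /cyclic_variation /=.
rewrite !cyclic_edges_cons -!/(path_variation _ _ _) -!cats1.
by rewrite /= path_variation_cons !path_variation_cat /= !path_variation_cons /=
  last_cat /= /path_variation /steps !big_nil; ring.
Qed.

Lemma cyclic_variation_rot f k s : cyclic_variation f (rot k s) = cyclic_variation f s.
Proof.
elim: k s => [|k IHk] s; first by rewrite rot0.
have [ks|ks] := ltnP k (size s); last by rewrite rot_oversize// ltnW.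
by rewrite -addn1 addnC rotD// ?IHk ?cyclic_variation_rot1// size_rot.
Qed.

End ClosedPaths.

Section ClosedPathsEq.
Context {R : realType} {T : eqType}.
Implicit Types (f : T -> R) (x : T) (s p q : seq T).

(** The closed path splits into a way from [x] to [y] and a way back, and each varies by at least
    [f x - f y]. *)
Lemma cyclic_variation_ge f s x y : x \in s -> y \in s ->
  2 * (f x - f y) <= cyclic_variation f s.
Proof.
move=> xs ys; have [i p ps] := rot_to xs.
rewrite -(cyclic_variation_rot f i) ps /cyclic_variation cyclic_edges_cons.
rewrite -/(path_variation _ _ _).
have : y \in x :: p by rewrite -ps mem_rot.
rewrite inE => /orP[/eqP->|].
  by rewrite subrr mulr0; apply: sumr_ge0 => *; exact: normr_ge0.
case/splitPr=> p1 p2; rewrite rcons_cat /= -cat_rcons path_variation_cat.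
rewrite last_rcons.
have := path_variation_ge f x (rcons p1 y).
have := path_variation_ge f y (rcons p2 x).
rewrite !last_rcons => h1 h2.
have := ler_norm (f x - f y); have := ler_norm (-(f y - f x)); rewrite normrN.
lra.
Qed.

Lemma seq_argmax f x s : x \in s ->
  exists2 y, y \in s & forall z, z \in s -> f z <= f y.
Proof.
elim: s x => // a s IHs x _; case: s IHs => [|b s] IHs.
  by exists a; rewrite ?mem_head// => z; rewrite inE => /eqP->.
have [y ys yP] := IHs b (mem_head _ _).
have [ay|/ltW ya] := leP (f a) (f y).
  exists y => [|z]; rewrite inE ?ys ?orbT// => /orP[/eqP->//|]; exact: yP.
exists a => [|z]; rewrite inE ?eqxx// => /orP[/eqP->//|/yP/le_trans]; exact.
Qed.

End ClosedPathsEq.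

Section ConvexPolygons.
Context {R : realType}.
Implicit Types (x y z u v : 'rV[R]_2) (s p : seq 'rV[R]_2).

Lemma dotE u v : dot u v = u 0 0 * v 0 0 + u 0 1 * v 0 1.
Proof.
rewrite /dot big_ord_recl big_ord1.
by congr (_ + u 0 _ * v 0 _); apply: val_inj.
Qed.

Lemma dotDr u v w : dot u (v + w) = dot u v + dot u w.
Proof. by rewrite !dotE !mxE; ring. Qed.

Lemma dotBr u v w : dot u (v - w) = dot u v - dot u w.
Proof. by rewrite !dotE !mxE; ring. Qed.

Lemma dotZr u a v : dot u (a *: v) = a * dot u v.
Proof. by rewrite !dotE !mxE; ring. Qed.

Lemma dotC u v : dot u v = dot v u.
Proof. by rewrite !dotE; ring. Qed.

Lemma dot_ge0 u : 0 <= dot u u.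
Proof. by rewrite dotE -!expr2 addr_ge0// sqr_ge0. Qed.

Lemma sqr_enorm u : enorm u ^+ 2 = dot u u.
Proof. by rewrite sqr_sqrtr// dot_ge0. Qed.

Lemma enorm_ge0 u : 0 <= enorm u.
Proof. exact: sqrtr_ge0. Qed.

Lemma enormN u : enorm (- u) = enorm u.
Proof. by congr Num.sqrt; rewrite !dotE !mxE; ring. Qed.

Lemma dot_le_enorm u v : dot u v <= enorm u * enorm v.
Proof.
have [|/ltW uv] := ler0P (dot u v).
  by move=> /le_trans; apply; rewrite mulr_ge0 ?enorm_ge0.
rewrite -sqrtrM ?dot_ge0// -[leLHS]ger0_norm// -sqrtr_sqr ler_wsqrtr//.
rewrite !dotE -subr_ge0 [X in 0 <= X](_ : _ = (u 0 0 * v 0 1 - u 0 1 * v 0 0) ^+ 2).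
  exact: sqr_ge0.
by ring.
Qed.

Lemma orient_rot x y z : orient y z x = orient x y z.
Proof. by rewrite /orient !mxE; ring. Qed.

Lemma orient_swap x y z : orient x z y = - orient x y z.
Proof. by rewrite /orient !mxE; ring. Qed.

(* The two sides are proportional to the values of [dot u] at the crossing
   point of the diagonals of the quadrilateral. *)
Lemma orient_diagonals u x y z t :
  orient y z t * dot u x + orient x y t * dot u z =
  orient x z t * dot u y + orient x y z * dot u t.
Proof. by rewrite /orient !dotE !mxE; ring. Qed.

(** The diagonals from [x] to [z] and from [y] to [t] cross; there [dot u] would exceed [m] on the
    first and be at most [m] on the second. *)
Lemma ccw_diagonals u x y z t (m : R) :
  0 < orient x y z -> 0 < orient x y t -> 0 < orient x z t ->
  0 < orient y z t -> dot u y <= m -> dot u t <= m ->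
  m < dot u x -> m < dot u z -> False.
Proof.
move=> xyz xyt xzt yzt ym tm mx mz; have := orient_diagonals u x y z t.
have : orient y z t + orient x y t = orient x z t + orient x y z.
  by rewrite /orient !mxE; ring.
nra.
Qed.

Lemma ccw_convex_rot1 s :
  ccw_convex_polygon s -> ccw_convex_polygon (rot 1 s).
Proof.
case: s => // x p xp i j k ij jk; rewrite size_rot rot1_cons /= => kp.
rewrite !nth_rcons (ltn_trans ij (leq_trans jk _))// (leq_trans jk)//.
have [kp'|kp'|kp'] := ltngtP k (size p); [exact: (xp i.+1 j.+1 k.+1)|lia|].
rewrite orient_rot; apply: (xp 0 i.+1 j.+1) => //=; rewrite ?nth_ord0//.
by rewrite -kp'.
Qed.

Lemma ccw_convex_rot k s :
  ccw_convex_polygon s -> ccw_convex_polygon (rot k s).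
Proof.
elim: k s => [|k IHk] s sP; first by rewrite rot0.
have [ks|ks] := ltnP k (size s); last by rewrite rot_oversize// ltnW.
by rewrite -[k.+1]add1n rotD//; apply: ccw_convex_rot1; exact: IHk.
Qed.

(** Along a convex polygon a linear form descends from a maximum to a minimum and climbs back, so
    its variation is twice its range. A failure of monotonicity yields a convex quadrilateral that
    contradicts [ccw_diagonals]. *)
Lemma ccw_variation_le s u (w : R) : ccw_convex_polygon s -> 0 <= w ->
  (forall x y, x \in s -> y \in s -> dot u x - dot u y <= w) ->
  cyclic_variation (dot u) s <= 2 * w.
Proof.
case: s => [|x0 s0] sP w0 sw.
  by rewrite /cyclic_variation /cyclic_edges/= big_nil mulr_ge0.
have [x xs xmax] := seq_argmax (dot u) (mem_head x0 s0).
have [i p ps] := rot_to xs.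
have {}xmax z : z \in x :: p -> dot u z <= dot u x.
  by rewrite -ps mem_rot; exact: xmax.
have {}sw a b : a \in x :: p -> b \in x :: p -> dot u a - dot u b <= w.
  by rewrite -ps !mem_rot; exact: sw.
have {}sP : ccw_convex_polygon (x :: p) by rewrite -ps; exact: ccw_convex_rot.
rewrite -(cyclic_variation_rot _ i) ps {s0 xs ps i x0}.
have [y ys ymin] := seq_argmax (fun z => - dot u z) (mem_head x p).
have {}ymin z : z \in x :: p -> dot u y <= dot u z.
  by move=> /ymin; rewrite lerN2.
rewrite /cyclic_variation cyclic_edges_cons -/(path_variation _ _ _).
(* If the minimum is found at the starting maximum, the form is constant on the polygon and there is
   no descending part to split off. *)
have := ys; rewrite inE => /orP[/eqP yx|yp].
  rewrite path_variation_nondecreasing ?last_rcons ?subrr ?mulr_ge0//.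
  have xpP a : a \in rcons p x -> dot u a = dot u x.
    rewrite mem_rcons => ap; apply/eqP; rewrite eq_le xmax// -yx ymin//.
  apply/(pathP x) => j jp; rewrite (xpP (nth x (rcons p x) j)) ?mem_nth//.
  by case: j jp => [|j]//= /ltnW jp; rewrite xpP// mem_nth.
have [p1 [p2 pE]] : exists p1, exists p2, p = p1 ++ y :: p2.
  by case/splitPr: yp => p1 p2; exists p1, p2.
set z := x :: p in sP xmax ymin sw ys *; set m := (size p1).+1.
have szz : size z = (m + (size p2).+1)%N by rewrite /z pE /= size_cat.
have mz : (m < size z)%N by rewrite szz addnS ltnS leq_addr.
have nz j : (j < size z)%N -> nth x z j \in z by move=> *; rewrite mem_nth.
have zm : nth x z m = y by rewrite /z pE /= nth_cat ltnn subnn.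
have decr j : (j < m)%N -> dot u (nth x z j.+1) <= dot u (nth x z j).
  case: j => [|j] jm; first by apply: xmax; apply: nz; rewrite szz; lia.
  have [<-|jm'] := eqVneq m j.+2.
    by rewrite zm; apply: ymin; apply: nz; rewrite szz; lia.
  (* A rise strictly before the minimum: the offending quadrilateral consists of the start, the
     vertices [j.+1] and [j.+2], and the minimum [m]. *)
  rewrite leNgt; apply/negP => lt_f.
  have j2 : (j.+2 < m)%N by lia.
  have j1 : (j.+1 < m)%N := ltnW j2.
  have j2z := ltn_trans j2 mz; have j1z := ltn_trans j1 mz.
  have h1 := sP 0%N j.+1 j.+2 isT (leqnn _) j2z.
  have h2 := sP 0%N j.+1 m isT j1 mz.
  have h3 := sP 0%N j.+2 m isT j2 mz.
  have h4 := sP j.+1 j.+2 m (leqnn _) j2 mz.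
  have ya := ymin _ (nz j.+1 j1z); have bx := xmax _ (nz j.+2 j2z).
  move: h1 h2 h3 h4; rewrite !(set_nth_default x 0)//.
  rewrite zm => h1 h2 h3 h4.
  exact: (ccw_diagonals h1 h2 h3 h4 (lexx _) ya (lt_le_trans lt_f bx) lt_f).
have incr j : (m <= j)%N -> (j < size p)%N ->
    dot u (nth x z j) <= dot u (nth x z j.+1).
  move=> mj jp; have jz : (j.+1 < size z)%N by [].
  move: mj; rewrite leq_eqVlt => /orP[/eqP mj|mj].
    by rewrite -mj zm; apply: ymin; apply: nz; rewrite mj.
  rewrite leNgt; apply/negP => lt_f.
  have js := ltnW jz.
  have h1 := sP 0%N m j isT mj js.
  have h2 := sP 0%N m j.+1 isT (leqW mj) jz.
  have h3 := sP 0%N j j.+1 (leq_ltn_trans (leq0n m) mj) (leqnn _) jz.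
  have h4 := sP m j j.+1 mj (leqnn _) jz.
  have ax := xmax _ (nz j js); have yb := ymin _ (nz j.+1 jz).
  move: h1 h2 h3 h4; rewrite !(set_nth_default x 0)//.
  rewrite zm => h1 h2 h3 h4.
  exact: (ccw_diagonals h1 h2 h3 h4 yb (lexx _) (lt_le_trans lt_f ax) lt_f).
rewrite pE rcons_cat /= -cat_rcons path_variation_cat last_rcons.
rewrite path_variation_nonincreasing ?path_variation_nondecreasing ?last_rcons.
- by have := sw _ _ (mem_head x p) ys; lra.
- apply/(pathP x) => j jp; rewrite size_rcons in jp.
  have zE k : nth x z (m + k) = nth x (y :: p2) k.
    rewrite /z pE -cat_cons nth_cat /= ltnNge leq_addr /=.
    by rewrite addKn.
  have -> : nth x (y :: rcons p2 x) j = nth x z (m + j).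
    by rewrite zE -rcons_cons nth_rcons /= jp.
  have [jp2|jp2] := ltnP j (size p2).
    have -> : nth x (rcons p2 x) j = nth x z (m + j).+1.
      by rewrite -addnS zE nth_rcons jp2.
    apply: incr; rewrite ?leq_addr// pE size_cat /= /m; lia.
  have -> : j = size p2 by apply/eqP; rewrite eqn_leq -ltnS jp.
  rewrite nth_rcons ltnn eqxx; apply: xmax; apply: nz; rewrite szz; lia.
- apply/(pathP x) => j jp; rewrite size_rcons in jp.
  have zE k : (k <= m)%N -> nth x z k = nth x (x :: rcons p1 y) k.
    by move=> km; rewrite /z pE -cat_rcons -cat_cons nth_cat /= size_rcons ltnS km.
  by have := decr j jp; rewrite !zE// ltnW.
Qed.

End ConvexPolygons.

(** * Extreme points, and the hull cycle as a strictly convex polygon *)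

Section Hull.
Context {R : realType}.
Implicit Types (x y z u v : 'rV[R]_2) (A P : set 'rV[R]_2).

Lemma conv_hull_sub A P : A `<=` P ->
  (forall x y (t : R), 0 <= t -> t <= 1 -> P x -> P y ->
     P (t *: x + (1 - t) *: y)) ->
  conv_hull A `<=` P.
Proof.
move=> AP cP; apply: smallest_sub => // x y t; rewrite !inE => Px Py.
exact: (cP x y t%:num).
Qed.

Lemma sub_conv_hull A : A `<=` conv_hull A.
Proof. exact: sub_smallest. Qed.

Lemma conv_hull_dot_le A u (m : R) : (forall x, A x -> dot u x <= m) ->
  forall x, conv_hull A x -> dot u x <= m.
Proof.
move=> Am; apply: conv_hull_sub => // x y t t0 t1 xm ym.
rewrite dotDr !dotZr; nra.
Qed.

Lemma rV2P x y : x 0 0 = y 0 0 -> x 0 1 = y 0 1 -> x = y.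
Proof.
move=> e0 e1; apply/rowP => k; case: (unliftP 0 k) => [j ->|->//].
by rewrite (ord1 j) (_ : lift 0 0 = 1)//; exact: val_inj.
Qed.

(** Of three distinct collinear points one lies strictly between the others and is not extreme; the
    position of [l] relative to 0 and 1 tells which. *)
Lemma extreme_orient_neq0 A x y z : extreme_point A x -> extreme_point A y ->
  extreme_point A z -> x != y -> x != z -> y != z -> orient x y z != 0.
Proof.
move=> [Ax ex] [Ay ey] [Az ez] xy xz yz; apply/negP => /eqP o0.
have [l zE] : exists l : R, z = x + l *: (y - x).
  have [d0|d0] := eqVneq (y 0 0) (x 0 0).
    have d1 : y 0 1 - x 0 1 != 0.
      by rewrite subr_eq0; apply: contra_neq xy => d1; apply: rV2P.
    exists ((z 0 1 - x 0 1) / (y 0 1 - x 0 1)).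
    move: o0; rewrite /orient !mxE d0 subrr mul0r sub0r => /eqP.
    rewrite oppr_eq0 mulf_eq0 (negbTE d1)/= subr_eq0 => /eqP zx.
    by apply: rV2P; rewrite !mxE ?d0 ?subrr ?mulr0 ?addr0// divfK// subrKC.
  have {}d0 : y 0 0 - x 0 0 != 0 by rewrite subr_eq0.
  exists ((z 0 0 - x 0 0) / (y 0 0 - x 0 0)).
  apply: rV2P; rewrite !mxE; first by rewrite divfK// subrKC.
  have := divfK d0 (z 0 0 - x 0 0); set q := _ / _ => qE.
  by move: o0; rewrite /orient !mxE -qE => o0; apply: (mulfI d0); lra.
have l0 : l != 0.
  by apply: contra_neq xz => l0; rewrite zE l0 scale0r addr0.
have l1 : l != 1.
  by apply: contra_neq yz => l1; rewrite zE l1 scale1r subrKC.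
have [lN|lP] := ltP l 0.
  have l1' : 0 < 1 - l by lra.
  have := ex y z (- l / (1 - l)) Ay Az.
  rewrite divr_gt0 ?ltr_pdivrMr ?oppr_gt0 ?mul1r// => /(_ isT).
  move=> /(_ ltac:(lra)) h; move/eqP: yz; apply; apply: h.
  by rewrite zE; apply: rV2P; rewrite !mxE; field; lra.
have {lP} lP : 0 < l by rewrite lt_neqAle eq_sym l0.
have [lb|lb] := ltP l 1.
  have := ez y x l Ay Ax lP lb.
  move=> h; move/eqP: xy; apply; apply/esym; apply: h.
  by rewrite {1}zE; apply: rV2P; rewrite !mxE; ring.
have {}lb : 1 < l by rewrite lt_neqAle eq_sym l1.
have := ey z x l^-1 Az Ax.
rewrite invr_gt0 lP invf_lt1// lb => /(_ isT isT) h.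
move/eqP: xz; apply; apply/esym; apply: h.
by rewrite zE; apply: rV2P; rewrite !mxE; field; lra.
Qed.

End Hull.

Section HullCycle.
Context {R : realType} {n : nat}.
Implicit Types (c d : 'M[R]_(n, 2)) (s : seq 'I_n).

Lemma packing_row_neq d i j : packing d -> i != j -> row i d != row j d.
Proof.
move=> dP /dP; rewrite /dist; apply: contraTneq => ->.
by rewrite subrr /enorm dotE !mxE mulr0 addr0 sqrtr0 -ltNge.
Qed.

(** A hull cycle gives only weak inequalities. Packing makes the rows distinct, and extremality then
    excludes collinear triples. *)
Lemma hull_cycle_edge_gt0 d s p q k : packing d -> hull_cycle d s ->
  (p, q) \in cyclic_edges s -> p \in s -> q \in s -> k \in s ->
  p != q -> p != k -> q != k ->
  0 < orient (row p d) (row q d) (row k d).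
Proof.
move=> dP [us sv se] pq ps qs ks npq npk nqk.
rewrite lt_neqAle se// andbT eq_sym.
by apply: extreme_orient_neq0; (try by apply/sv); exact: packing_row_neq.
Qed.

Lemma cyclic_edges_nth (T : eqType) (x0 : T) (s : seq T) i : (i.+1 < size s)%N ->
  (nth x0 s i, nth x0 s i.+1) \in cyclic_edges s.
Proof.
move=> si; have -> : (nth x0 s i, nth x0 s i.+1) = nth (x0, x0) (cyclic_edges s) i.
  rewrite /cyclic_edges nth_zip ?size_rot//; congr pair.
  case: s si => // x p ip; rewrite rot1_cons nth_rcons /=.
  by rewrite -ltnS ip.
by rewrite mem_nth// size1_zip ?size_rot// ltnW.
Qed.

(* Seen from the vertex [i], all later vertices lie in the open half-plane to
   the left of the edge leaving [i], where positive orientation is transitive. *)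
Lemma hull_cycle_ccw d s : packing d -> hull_cycle d s ->
  ccw_convex_polygon [seq row i d | i <- s].
Proof.
move=> dP sP i j k ij jk; rewrite size_map => ks.
have is_ : (i < size s)%N by lia.
case: s sP ks is_ => // x0 s' ; set s := x0 :: s' => sP ks is_.
have js : (j < size s)%N by lia.
rewrite !(nth_map x0)//; set z := fun l => row (nth x0 s l) d.
rewrite -!/(z _).
have us : uniq s by case: sP.
have edge l m : (l.+1 < size s)%N -> (m < size s)%N -> m != l -> m != l.+1 ->
    0 < orient (z l) (z l.+1) (z m).
  move=> ls ms ml ml1; have ls' := ltnW ls.
  apply: (hull_cycle_edge_gt0 dP sP); rewrite ?mem_nth ?nth_uniq//.
  - exact: cyclic_edges_nth.
  - by rewrite neq_ltn ltnSn.
  - by rewrite eq_sym.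
  - by rewrite eq_sym.
elim: k jk ks => // k IHk; rewrite ltnS leq_eqVlt => /orP[/eqP<-|jk] ks.
  rewrite -orient_rot; apply: edge => //; lia.
have IH := IHk jk (ltnW ks).
have h1 : 0 < orient (z i) (z k) (z k.+1).
  by rewrite -orient_rot; apply: edge => //; lia.
have h2 : 0 < orient (z i) (z i.+1) (z k) by apply: edge => //; lia.
have h3 : 0 < orient (z i) (z i.+1) (z k.+1) by apply: edge => //; lia.
have h4 : 0 <= orient (z i) (z i.+1) (z j).
  have [->|ji] := eqVneq j i.+1; last by apply/ltW/edge => //; lia.
  by rewrite /orient !mxE; lra.
(* Multiplied by a positive orientation, the goal expands by the three-term Plücker relation for the
   vectors from [z i] to [z i.+1], [z j], [z k], [z k.+1]: a nonnegative term plus a positive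
   one. *)
rewrite -(pmulr_rgt0 _ h2).
have -> : orient (z i) (z i.+1) (z k) * orient (z i) (z j) (z k.+1) =
  orient (z i) (z i.+1) (z j) * orient (z i) (z k) (z k.+1) +
  orient (z i) (z i.+1) (z k.+1) * orient (z i) (z j) (z k).
  by rewrite /orient !mxE; ring.
by rewrite ltr_wpDl// ?mulr_gt0// mulr_ge0// ltW.
Qed.

(** The maximizers of [dot u] may fill a hull edge and include centres that are not extreme.
    Breaking ties by the orthogonal form [dot w] selects an end of that edge. *)
Lemma hull_vertex_argmax d (u : 'rV[R]_2) (i0 : 'I_n) : u != 0 ->
  exists2 i, hull_vertex d i & forall k, dot u (row k d) <= dot u (row i d).
Proof.
move=> u0.
have [i1 _ i1max] := seq_argmax (fun k => dot u (row k d)) (mem_enum 'I_n i0).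
pose w : 'rV[R]_2 := \row_k (if k == 0 then - u 0 1 else u 0 0).
pose t := [seq k <- enum 'I_n | dot u (row k d) == dot u (row i1 d)].
have i1t : i1 \in t by rewrite mem_filter eqxx mem_enum.
have [i it imax] := seq_argmax (fun k => dot w (row k d)) i1t.
have iE : dot u (row i d) = dot u (row i1 d).
  by apply/eqP; move: it; rewrite mem_filter => /andP[].
have umax k : dot u (row k d) <= dot u (row i d).
  by rewrite iE; apply: i1max; rewrite mem_enum.
exists i => //.
(* The points lexicographically at most [row i d] form a convex set, so the bound passes from the
   centres to their hull. *)
pose P := [set x | dot u x < dot u (row i d) \/
  dot u x = dot u (row i d) /\ dot w x <= dot w (row i d)].
have hullP : centre_hull d `<=` P.
  apply: conv_hull_sub => [_ [k _ <-]|x y a a0 a1 Px Py].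
    have := umax k; rewrite le_eqVlt => /orP[/eqP kE|]; last by left.
    by right; split=> //; apply: imax; rewrite mem_filter kE iE eqxx mem_enum.
  rewrite /P /= !dotDr !dotZr.
  have [->|an0] := eqVneq a 0; first by rewrite !(mul0r, subr0, add0r, mul1r).
  have [->|an1] := eqVneq a 1; first by rewrite !(mul0r, subrr, addr0, mul1r).
  have {an0}a0 : 0 < a by rewrite lt_neqAle eq_sym an0.
  have {an1}a1 : a < 1 by rewrite lt_neqAle an1.
  by case: Px => [|[]] => px; case: Py => [|[]] => py; (try by left; nra);
    right; split; nra.
split; first by apply: sub_conv_hull; exists i.
move=> y z a /hullP yP /hullP zP a0 a1 iyz.
have ui : dot u (row i d) = a * dot u y + (1 - a) * dot u z.
  by rewrite {1}iyz dotDr !dotZr.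
have wi : dot w (row i d) = a * dot w y + (1 - a) * dot w z.
  by rewrite {1}iyz dotDr !dotZr.
have uyz : dot u y = dot u z.
  by case: yP => [|[]] => yP; case: zP => [|[]] => zP *; nra.
have wyz : dot w y = dot w z.
  by case: yP => [|[]] => yP; case: zP => [|[]] => zP *; nra.
have uu : 0 < dot u u.
  rewrite lt_neqAle dot_ge0 andbT eq_sym; apply: contra_neq u0.
  rewrite dotE => uu.
  have /eqP := uu; rewrite paddr_eq0 -?expr2 ?sqr_ge0// !sqrf_eq0.
  by move=> /andP[/eqP h0 /eqP h1]; apply: rV2P; rewrite !mxE.
(* The forms [dot u] and [dot w] determine a point, by Cramer with determinant [dot u u]. *)
move: uyz wyz uu; rewrite !dotE !mxE /= => e1 e2 uu.
have := congr1 ( *%R (u 0 0)) e1; have := congr1 ( *%R (u 0 1)) e1.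
have := congr1 ( *%R (u 0 0)) e2; have := congr1 ( *%R (u 0 1)) e2.
by move=> *; apply: rV2P; apply: (mulfI (lt0r_neq0 uu)); lra.
Qed.

End HullCycle.

(** * Cauchy-Crofton *)

Section Crofton.
Context {R : realType}.
Implicit Types (x t : R) (u e : 'rV[R]_2).

Definition direction t : 'rV[R]_2 := \row_k (if k == 0 then cos t else sin t).

Lemma dot_direction t e : dot (direction t) e = cos t * e 0 0 + sin t * e 0 1.
Proof. by rewrite dotE !mxE. Qed.

(** At 0 the sign factor does not affect the absolute value of the difference quotient of [1 - cos],
    which tends to [sin 0 = 0]. *)
Lemma is_derive_abs_sin x : - pi <= x -> x <= pi ->
  is_derive x 1 (fun y : R => Num.sg y * (1 - cos y)) `|sin x|.
Proof.
move=> x1 x2.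
have dc (y : R) : is_derive y 1 (fun y : R => 1 - cos y) (sin y).
  by apply: is_derive_eq; rewrite add0r mul1r opprK.
have [x0|x0|->] := ltgtP x 0.
- have sx : sin x <= 0.
    by rewrite -oppr_ge0 -sinN sin_ge0_pi// oppr_ge0 ltW//= lerNl.
  rewrite ler0_norm//.
  apply: (@near_eq_is_derive _ _ _ (fun y : R => - (1 - cos y))).
    near=> y; rewrite ltr0_sg ?mulN1r//.
    by near: y; exact: lt_nbhsl.
- have sx : 0 <= sin x by rewrite sin_ge0_pi// ltW.
  rewrite ger0_norm//.
  apply: (@near_eq_is_derive _ _ _ (fun y : R => 1 - cos y)).
    near=> y; rewrite gtr0_sg ?mul1r//.
    by near: y; exact: lt_nbhsr.
- rewrite sin0 normr0.
  have h0 : h^-1 *: ((fun y : R => Num.sg y * (1 - cos y)) (h *: 1 + 0) -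
      Num.sg 0 * (1 - cos 0)) @[h --> (0 : R)^'] --> (0 : R).
    apply/norm_cvg0P.
    have [d0 /esym e0] := dc 0; rewrite sin0 in e0.
    have := d0; rewrite /derivable => /cvg_ex[l lP].
    have l0 : l = 0 by rewrite e0; apply/esym/cvg_lim.
    move: lP; rewrite l0 => lP.
    refine (cvg_trans _ (iffRL (norm_cvg0P _) lP)); apply: near_eq_cvg.
    near=> h; rewrite /= sgr0 mul0r subr0 cos0 subrr subr0 !addr0.
    rewrite !normrM normr_sg [_ *: 1]mulr1 (_ : h != 0) ?mul1r//.
    by near: h; exact: nbhs_dnbhs_neq.
  by apply: DeriveDef; [exact: (cvgP _ h0) | exact: (cvg_lim _ h0)].
Unshelve. all: by end_near. Qed.

(** Up to sign [dot (direction t) e] is [enorm e] times a shifted sine, and the absolute value of a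
    sine has integral 2 over any half turn. *)
Lemma crofton_vector e : exists2 G : R -> R,
  (forall t, 0 <= t -> t <= pi -> is_derive t 1 G `|dot (direction t) e|) &
  G pi - G 0 = 2 * enorm e.
Proof.
set r := enorm e.
have r2 : r ^+ 2 = e 0 0 ^+ 2 + e 0 1 ^+ 2 by rewrite sqr_enorm dotE !expr2.
have [r0|r0] := eqVneq r 0.
  exists (cst 0) => [t _ _|]; last by rewrite subrr r0 mulr0.
  move: r2; rewrite r0 expr0n /= => /esym/eqP.
  rewrite paddr_eq0 ?sqr_ge0// !sqrf_eq0 => /andP[/eqP e0 /eqP e1].
  rewrite dot_direction e0 e1 !mulr0 addr0 normr0; exact: is_derive_cst.
have {r0}rP : 0 < r by rewrite lt_neqAle eq_sym r0 enorm_ge0.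
have [t0 [t00 t0pi tE]] : exists t0, [/\ 0 <= t0, t0 <= pi &
    forall t, `|dot (direction t) e| = r * `|sin (t - t0)|].
  (* The sign is chosen so that [sin t0 >= 0]: then [t0] is a value of [acos] in [[0, pi]] and
     [t - t0] stays in [[-pi, pi]], the range of [is_derive_abs_sin]. *)
  pose sg : R := if e 0 0 <= 0 then 1 else -1.
  have sg2 : sg * sg = 1 by rewrite /sg; case: ifP => _; ring.
  pose b := sg * e 0 1 / r.
  have b2 : b ^+ 2 = 1 - (e 0 0 / r) ^+ 2.
    rewrite /b !exprMn -[sg ^+ 2]/(sg * sg) sg2 mul1r !exprVn r2.
    by field; rewrite -r2 expf_neq0// gt_eqF.
  have bB : -1 <= b <= 1.
    rewrite -ler_norml -(@ler_pXn2r _ 2) ?nnegrE// expr1n real_normK ?num_real//.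
    by rewrite b2 lerBlDr lerDl sqr_ge0.
  have [/andP[t00 t0pi] cost0] := acos_def bB.
  exists (acos b); split=> // t.
  have sint0 : sin (acos b) = - sg * e 0 0 / r.
    rewrite sin_acos// b2 opprB addrC subrK sqrtr_sqr normrM.
    rewrite [`|r^-1|]gtr0_norm ?invr_gt0//; congr (_ / r).
    rewrite /sg; case: ifPn => [e0|]; first by rewrite ler0_norm// mulN1r.
    by rewrite -ltNge => e0; rewrite opprK mul1r gtr0_norm.
  rewrite sinB cost0 sint0 dot_direction.
  rewrite -[X in X * `|_|](gtr0_norm rP) -normrM.
  rewrite (_ : r * _ = sg * (cos t * e 0 0 + sin t * e 0 1)).
    rewrite normrM (_ : `|sg| = 1) ?mul1r// /sg.
    by case: ifP => _; rewrite ?normrN normr1.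
  by rewrite /b; field; rewrite gt_eqF.
exists (fun t => r * (Num.sg (t - t0) * (1 - cos (t - t0)))) => [t t0' tpi|].
  rewrite tE.
  have dS : is_derive (t - t0) 1 (fun y : R => Num.sg y * (1 - cos y)) `|sin (t - t0)|.
    by apply: is_derive_abs_sin; lra.
  have dB : is_derive t 1 (fun t : R => t - t0) 1.
    by apply: is_derive_eq; rewrite subr0.
  have := @is_derive1_comp R _ (fun t => t - t0) t _ _ dS dB.
  rewrite mulr1 => dSB.
  exact: (is_deriveZ r dSB).
rewrite sub0r cosN.
have -> : cos (pi - t0) = - cos t0.
  by rewrite cosB cospi sinpi mul0r addr0 mulN1r.
have -> : Num.sg (pi - t0) * (1 - - cos t0) = 1 + cos t0.
  rewrite opprK; have [->|tpi] := eqVneq t0 pi; first by rewrite cospi !subrr mulr0.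
  by rewrite gtr0_sg ?mul1r// subr_gt0 lt_neqAle tpi.
have -> : Num.sg (- t0) * (1 - cos t0) = - (1 - cos t0).
  have [->|t0n] := eqVneq t0 0; first by rewrite cos0 subrr mulr0 oppr0.
  by rewrite ltr0_sg ?mulN1r// oppr_lt0 lt_neqAle eq_sym t0n.
by ring.
Qed.

Lemma crofton (s : seq 'rV[R]_2) : exists2 G : R -> R,
  (forall t, 0 <= t -> t <= pi ->
     is_derive t 1 G (\sum_(e <- s) `|dot (direction t) e|)) &
  G pi - G 0 = 2 * \sum_(e <- s) enorm e.
Proof.
elim: s => [|e s [G dG GE]].
  exists (cst 0) => [t _ _|]; rewrite !big_nil ?subrr ?mulr0//.
  exact: is_derive_cst.
have [H dH HE] := crofton_vector e.
exists (H + G) => [t t0 tpi|].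
  by rewrite big_cons; apply: is_deriveD; [exact: dH | exact: dG].
rewrite big_cons mulrDr -HE -GE -[LHS]/(H pi + G pi - (H 0 + G 0)); ring.
Qed.

(* Cauchy-Crofton in comparison form: lengths are averages of the lengths of
   the projections over all directions. *)
Lemma crofton_le (s1 s2 : seq 'rV[R]_2) (k : R) :
  (forall t, 0 <= t -> t <= pi ->
     \sum_(e <- s1) `|dot (direction t) e| <=
     \sum_(e <- s2) `|dot (direction t) e| + k) ->
  2 * \sum_(e <- s1) enorm e <= 2 * \sum_(e <- s2) enorm e + k * pi.
Proof.
move=> s12; have [G1 dG1 <-] := crofton s1; have [G2 dG2 <-] := crofton s2.
(* The integral inequality becomes the monotonicity of an antiderivative of the difference. *)
have dG t : 0 <= t -> t <= pi -> is_derive t 1 (fun t => G2 t + k * t - G1 t)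
    (\sum_(e <- s2) `|dot (direction t) e| + k -
     \sum_(e <- s1) `|dot (direction t) e|).
  move=> t0 tpi; have := dG1 _ t0 tpi; have := dG2 _ t0 tpi => d2 d1.
  have := is_deriveB (is_deriveD d2 (is_deriveZ k (is_derive_id t 1))) d1.
  by rewrite [k *: 1]mulr1.
have [] := @MVT_segment R (fun t => G2 t + k * t - G1 t) (fun t =>
    \sum_(e <- s2) `|dot (direction t) e| + k -
    \sum_(e <- s1) `|dot (direction t) e|) 0 pi.
- exact: pi_ge0.
- by move=> t; rewrite in_itv/= => /andP[/ltW t0 /ltW tpi]; exact: dG.
- apply: derivable_within_continuous => t; rewrite in_itv/= => /andP[t0 tpi].
  by have [] := dG t t0 tpi.
move=> t; rewrite in_itv/= => /andP[t0 tpi] GE.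
have : 0 <= G2 pi + k * pi - G1 pi - (G2 0 + k * 0 - G1 0).
  by rewrite GE subr0 mulr_ge0 ?pi_ge0// subr_ge0 s12.
lra.
Qed.

End Crofton.

(** * Strictly convex polygons from support points *)

Section Directions.
Context {R : realType}.
Implicit Types (t a b : R) (u v w x y z : 'rV[R]_2).

Definition cross u v : R := u 0 0 * v 0 1 - u 0 1 * v 0 0.

Lemma dot_directions a b : dot (direction a) (direction b) = cos (b - a).
Proof. by rewrite dotE !mxE/= cosB; ring. Qed.

Lemma cross_directions a b : cross (direction a) (direction b) = sin (b - a).
Proof. by rewrite /cross !mxE/= sinB; ring. Qed.

Lemma enorm_direction a : enorm (direction a) = 1.
Proof. by rewrite /enorm dot_directions subrr cos0 sqrtr1. Qed.

Lemma direction_neq0 a : direction a != 0.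
Proof.
apply: contra_eq_neq (enorm_direction a) => ->.
by rewrite /enorm dotE !mxE mulr0 addr0 sqrtr0 eq_sym oner_eq0.
Qed.

Lemma directionDpi a v : dot (direction (a + pi)) v = - dot (direction a) v.
Proof. by rewrite !dot_direction cosDpi sinDpi; ring. Qed.

Lemma cos_lt1 t : 0 < t -> t < 2 * pi -> cos t < 1.
Proof.
move=> t0 t2; have -> : t = t / 2 + t / 2 by lra.
have s0 : 0 < sin (t / 2) by apply: sin_gt0_pi; lra.
have := cos2Dsin2 (t / 2); rewrite cosD; nra.
Qed.

Definition two_positive (p q r : R) : Prop :=
  [\/ 0 < p /\ 0 < q, 0 < q /\ 0 < r | 0 < p /\ 0 < r].

(* Of three arcs of total length [2 * pi] at most one reaches [pi]. *)
Lemma directions_two_positive a b c : a < b -> b < c -> c < a + 2 * pi ->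
  two_positive (cross (direction a) (direction b))
    (cross (direction b) (direction c)) (cross (direction c) (direction a)).
Proof.
move=> ab bc ca; rewrite !cross_directions.
have sP t : 0 < t -> t < pi -> 0 < sin t.
  by move=> t0 tpi; rewrite sin_gt0_pi ?t0.
have sN : pi < c - a -> 0 < sin (a - c).
  move=> h; rewrite -[a - c](addrK (2 * pi)) -/(_ - _) sinB.
  have -> : sin (2 * pi) = 0 :> R by rewrite mulr_natl sin2pi.
  have -> : cos (2 * pi) = 1 :> R by rewrite mulr_natl cos2pi.
  rewrite mulr0 subr0 mulr1; apply: sP; lra.
have [h1|h1] := ltP (b - a) pi; last first.
  by apply: Or32; split; [apply: sP; lra | apply: sN; lra].
have [h2|h2] := ltP (c - b) pi; last first.
  by apply: Or33; split; [apply: sP; lra | apply: sN; lra].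
by apply: Or31; split; apply: sP; lra.
Qed.

(** Each cross product times [orient x y z] is a determinant in the values of the forms on [y - x]
    and [z - x]. Strict maximality makes two of these three determinants positive; two of the cross
    products are positive too, so one index has both. *)
Lemma support_points_ccw u v w x y z :
  two_positive (cross u v) (cross v w) (cross w u) ->
  dot u y < dot u x -> dot u z < dot u x ->
  dot v x < dot v y -> dot v z < dot v y ->
  dot w x < dot w z -> dot w y < dot w z -> 0 < orient x y z.
Proof.
move=> uvw uxy uxz vyx vyz wzx wzy.
pose u1 := dot u (y - x); pose u2 := dot u (z - x).
pose v1 := dot v (y - x); pose v2 := dot v (z - x).
pose w1 := dot w (y - x); pose w2 := dot w (z - x).
have eA : cross u v * orient x y z = u1 * v2 - u2 * v1.
  by rewrite /cross /orient /u1 /u2 /v1 /v2 !dotE !mxE; ring.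
have eB : cross v w * orient x y z = v1 * w2 - v2 * w1.
  by rewrite /cross /orient /v1 /v2 /w1 /w2 !dotE !mxE; ring.
have eC : cross w u * orient x y z = w1 * u2 - w2 * u1.
  by rewrite /cross /orient /w1 /w2 /u1 /u2 !dotE !mxE; ring.
have u10 : u1 < 0 by rewrite /u1 dotBr subr_lt0.
have u20 : u2 < 0 by rewrite /u2 dotBr subr_lt0.
have v10 : 0 < v1 by rewrite /v1 dotBr subr_gt0.
have v21 : v2 < v1 by rewrite /v1 /v2 !dotBr ltrD2r.
have w20 : 0 < w2 by rewrite /w2 dotBr subr_gt0.
have w12 : w1 < w2 by rewrite /w1 /w2 !dotBr ltrD2r.
have pos p : 0 < p -> 0 < p * orient x y z -> 0 < orient x y z.
  by move=> p0; rewrite pmulr_rgt0.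
have : two_positive (cross u v * orient x y z) (cross v w * orient x y z)
    (cross w u * orient x y z).
  rewrite eA eB eC.
  have [A0|A0] := ltP 0 (u1 * v2 - u2 * v1); last first.
    have v20 : 0 < v2 by nra.
    have u12 : u1 < u2 by nra.
    apply: Or32; split; last by nra.
    by have [w10|w10] := leP w1 0; nra.
  have [C0|C0] := ltP 0 (w1 * u2 - w2 * u1); last first.
    have w10 : 0 < w1 by nra.
    have u21 : u2 < u1 by nra.
    apply: Or31; split=> //.
    by have [v20|v20] := leP v2 0; nra.
  by apply: Or33.
by case: uvw => [] [h1 h2] [] [h3 h4]; (try exact: (pos _ h1));
  (try exact: (pos _ h2)).
Qed.

Lemma dot_direction_lipschitz v a b :
  `|dot (direction a) v - dot (direction b) v| <=
  (`|v 0 0| + `|v 0 1|) * `|a - b|.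
Proof.
wlog : a b / b <= a => [H|ab].
  have [/H|/ltW/H]// := leP b a.
  by rewrite distrC [`|b - a|]distrC.
have df (t : R) : is_derive t 1 (fun t => dot (direction t) v)
    (- sin t * v 0 0 + cos t * v 0 1).
  have -> : (fun t => dot (direction t) v) =
      (fun t : R => v 0 0 * cos t + v 0 1 * sin t).
    by apply/funext => r; rewrite dot_direction mulrC [sin r * _]mulrC.
  apply: is_derive_eq; rewrite /GRing.scale /=; ring.
have [] := @MVT_segment R (fun t => dot (direction t) v)
   (fun t => - sin t * v 0 0 + cos t * v 0 1) b a ab.
- by apply: derivable_within_continuous => t _; have [] := df t.
move=> t _ ->; rewrite normrM ler_wpM2r//.
apply: le_trans (ler_normD _ _) _; rewrite !normrM normrN.
rewrite lerD// ler_piMl// ler_norml.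
  by rewrite sin_geN1 sin_le1.
by rewrite cos_geN1 cos_le1.
Qed.

(** The index stops at [N] although [t] may reach [delta * N.+1%:R]: in the application that
    multiple is a full turn, the same direction as 0. *)
Lemma nearest_multiple (delta t : R) (N : nat) : 0 <= t -> t <= delta * N.+1%:R ->
  exists2 k, (k <= N)%N & `|t - delta * k%:R| <= delta.
Proof.
move=> t0; elim: N => [|N IHN] tN.
  by exists 0%N => //; rewrite mulr0 subr0 ger0_norm//; rewrite mulr1 in tN.
have [/IHN[k kN kP]|h] := leP t (delta * N.+1%:R).
  by exists k => //; rewrite (leq_trans kN).
exists N.+1 => //; rewrite gtr0_norm ?subr_gt0// lerBlDl.
by move: tN; rewrite -[N.+2%:R]natr1 mulrDr mulr1.
Qed.

End Directions.

(** * Perimeter of the hull of the disks *)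

Section Frontier.
Context {R : realType}.
Implicit Types (u x y : 'rV[R]_2) (A : set 'rV[R]_2) (s : seq 'rV[R]_2).

Lemma dot_continuous u : continuous (dot u).
Proof.
have -> : dot u = cst (u 0 0) \* (fun v : 'rV[R]_2 => v 0 0) \+
    cst (u 0 1) \* (fun v : 'rV[R]_2 => v 0 1).
  by apply/funext => v; rewrite dotE.
move=> v; apply: continuousD; apply: continuousM; try exact: cst_continuous;
  exact: coord_continuous.
Qed.

Lemma frontier_dot_le A u x (m : R) : (forall y, A y -> dot u y <= m) ->
  frontier A x -> dot u x <= m.
Proof.
move=> Am [+ _]; suff /[apply] : closure A `<=` [set y | dot u y <= m] by [].
have Am' : A `<=` [set y | dot u y <= m] by [].
apply: subset_trans (closure_subset Am') _.
have : closed [set y | dot u y <= m].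
  have -> : [set y | dot u y <= m] = dot u @^-1` [set a | a <= m] by [].
  by apply: closed_comp => [y _|]; [exact: dot_continuous | exact: closed_le].
by rewrite closure_id => <-.
Qed.

(** Any small step from [x] along [u] leaves [A]. *)
Lemma support_point_frontier A u x : u != 0 -> A x ->
  (forall y, A y -> dot u y <= dot u x) -> frontier A x.
Proof.
move=> u0 Ax xmax; split; first exact: subset_closure.
rewrite /interior /= => xA.
have xc : x + t *: u @[t --> (0 : R)] --> x.
  rewrite -[X in _ --> X]addr0 -(scale0r u).
  by apply: cvgD; [exact: cvg_cst | apply: cvgZr_tmp; exact: cvg_id].
have /nbhs_ballP[e /= e0 eA] := xc _ xA.
have /xmax : A (x + (e / 2) *: u).
  apply: eA; rewrite /ball /= sub0r normrN gtr0_norm; lra.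
rewrite dotDr dotZr gerDl pmulr_rle0; last lra.
apply/negP; rewrite -ltNge lt_neqAle dot_ge0 andbT eq_sym.
apply: contra_neq u0; rewrite dotE => uu.
have /eqP := uu; rewrite paddr_eq0 -?expr2 ?sqr_ge0// !sqrf_eq0.
by move=> /andP[/eqP h0 /eqP h1]; apply: rV2P; rewrite !mxE.
Qed.

Lemma polygon_lengthE s :
  polygon_length s = \sum_(v <- [seq e.2 - e.1 | e <- cyclic_edges s]) enorm v.
Proof. by rewrite big_map. Qed.

Lemma cyclic_variation_dotE u s : cyclic_variation (dot u) s =
  \sum_(v <- [seq e.2 - e.1 | e <- cyclic_edges s]) `|dot u v|.
Proof. by rewrite big_map; apply: eq_bigr => e _; rewrite dotBr. Qed.

End Frontier.

Section Perimeter.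
Context {R : realType} {n : nat}.
Variables (d : 'M[R]_(n, 2)) (s : seq 'I_n) (i0 : 'I_n).
Hypotheses (dP : packing d) (sP : hull_cycle d s).
Implicit Types (u x y : 'rV[R]_2).

Let hull_polygon : seq 'rV[R]_2 := [seq row i d | i <- s].

Let K := conv_hull (disks d).

Lemma hull_cycle_argmax u : u != 0 ->
  exists2 i, i \in s & forall k, dot u (row k d) <= dot u (row i d).
Proof.
move=> /(hull_vertex_argmax d i0)[i iv imax]; exists i => //.
by have [_ sv _] := sP; apply/sv.
Qed.

Lemma hull_dot_le t i : (forall k, dot (direction t) (row k d) <=
    dot (direction t) (row i d)) ->
  forall x, K x -> dot (direction t) x <= dot (direction t) (row i d) + 1.
Proof.
move=> imax; apply: conv_hull_dot_le => x [k xk].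
rewrite -[x](subrK (row k d)) dotDr addrC lerD//.
apply: le_trans (dot_le_enorm _ _) _.
by rewrite enorm_direction mul1r.
Qed.

(** In each direction the projection of [K] has width at most [M - m + 2], so the variation along
    [q] exceeds that along the hull polygon by at most 4; Crofton turns this into [4 * pi] for
    doubled lengths. *)
Lemma inscribed_length_le (q : seq 'rV[R]_2) :
  (forall x, x \in q -> frontier K x) -> ccw_convex_polygon q ->
  polygon_length q <= polygon_length hull_polygon + 2 * pi.
Proof.
move=> qK qP.
suff : 2 * polygon_length q <= 2 * polygon_length hull_polygon + 4 * pi by lra.
rewrite !polygon_lengthE; apply: crofton_le => t _ _.
rewrite -!cyclic_variation_dotE.
have [i is_ imax] := hull_cycle_argmax (direction_neq0 t).
have [j js jmax] := hull_cycle_argmax (direction_neq0 (t + pi)).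
have iS : row i d \in hull_polygon by apply: map_f.
have jS : row j d \in hull_polygon by apply: map_f.
have := cyclic_variation_ge (dot (direction t)) iS jS.
set M := dot _ (row i d); set m := dot _ (row j d) => Mm.
have mM : m <= M by exact: imax.
suff : cyclic_variation (dot (direction t)) q <= 2 * (M - m + 2) by lra.
apply: ccw_variation_le => // [|x y xq yq]; first lra.
have := frontier_dot_le (hull_dot_le imax) (qK x xq).
have := frontier_dot_le (hull_dot_le jmax) (qK y yq).
by rewrite !directionDpi -/M -/m; lra.
Qed.

(** Support points in [N.+1] equally spaced directions see the width of [K] in every direction up to
    a multiple of the spacing [delta]. *)
Lemma inscribed_length_ge (eps : R) : 0 < eps ->
  exists q, [/\ forall x, x \in q -> frontier K x, ccw_convex_polygon q &
    polygon_length hull_polygon + 2 * pi <= polygon_length q + eps].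
Proof.
move=> eps0.
pose B : R := \sum_i (`|d i 0| + `|d i 1|).
have rowB (i : 'I_n) : `|row i d 0 0| + `|row i d 0 1| <= B.
  rewrite !mxE /B (bigD1 i)//= lerDl; apply: sumr_ge0 => k _.
  by rewrite addr_ge0.
have B0 : 0 <= B by apply: sumr_ge0 => k _; rewrite addr_ge0.
have pi0 : 0 < pi :> R := pi_gt0 R.
(* The final error in length is [4 * (B + 1) * delta * pi] with [delta = 2 * pi / N.+1%:R], that is
   [C / N.+1%:R]. *)
pose C := 8 * (B + 1) * pi * pi.
have C0 : 0 < C by rewrite !mulr_gt0//; lra.
have [N NP] : exists N : nat, C / eps <= N.+1%:R.
  exists (Num.bound (C / eps)); have := archi_boundP (ltW (divr_gt0 C0 eps0)).
  by rewrite -natr1; lra.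
pose delta : R := 2 * pi / N.+1%:R.
have deltaN : delta * N.+1%:R = 2 * pi by rewrite /delta divfK// pnatr_eq0.
have delta0 : 0 < delta by rewrite divr_gt0// mulr_gt0.
pose u k := direction (delta * k%:R).
have /choice[p pP] : forall k, exists i, i \in s /\
    forall l, dot (u k) (row l d) <= dot (u k) (row i d).
  move=> k; have := hull_cycle_argmax (direction_neq0 (delta * k%:R)).
  by case=> i is_ imax; exists i.
pose x k := row (p k) d + u k.
have xsupp k y : K y -> dot (u k) y <= dot (u k) (x k).
  move=> /(hull_dot_le (pP k).2) /le_trans; apply.
  by rewrite dotDr lerD2l dot_directions subrr cos0.
have xK k : K (x k).
  apply: sub_conv_hull; exists (p k).
  by rewrite /x addrC addKr enorm_direction.
exists (mkseq x N.+1); split.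
- move=> _ /mapP[k _ ->].
  by apply: (support_point_frontier (direction_neq0 (delta * k%:R))) => //; exact: xsupp.
(* In the direction [u k] the centre of [x l] is no farther than that of [x k], and its unit vector
   contributes the cosine of a nonzero angle, below 1. *)
- have strict k l : (k <= N)%N -> (l <= N)%N -> k != l ->
      dot (u k) (x l) < dot (u k) (x k).
    move=> kN lN kl; rewrite !dotDr.
    apply: ler_ltD; first exact: (pP k).2.
    rewrite !dot_directions subrr cos0.
    wlog {xsupp xK x kl} kl : k l kN lN / (k < l)%N.
      move=> H; move: kl; rewrite neq_ltn => /orP[kl|lk]; first exact: H.
      by rewrite -cosN opprB; exact: H.
    rewrite -mulrBr; apply: cos_lt1; first by rewrite mulr_gt0// subr_gt0 ltr_nat.
    rewrite -deltaN ltr_pM2l// ltrBlDr -natrD ltr_nat; lia.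
  move=> i j k ij jk; rewrite size_mkseq => kN.
  rewrite !nth_mkseq//; [|lia|lia].
  apply: (@support_points_ccw _ (u i) (u j) (u k)); (try by apply: strict; lia).
  apply: directions_two_positive; rewrite ?ltr_pM2l ?ltr_nat//.
  rewrite -deltaN -mulrDr ltr_pM2l// -natrD ltr_nat; lia.
(* Replacing [t] by a grid angle costs at most [B * delta] on a centre and [(B + 2) * delta] on
   [x k], hence [2 * (B + 1) * delta]. *)
have near_dir t : 0 <= t -> t <= 2 * pi -> exists2 k, (k <= N)%N &
    forall l, dot (direction t) (row l d) + 1 - 2 * (B + 1) * delta <=
      dot (direction t) (x k).
  rewrite -deltaN => t0 tN.
  have [k kN tk] := nearest_multiple t0 tN; exists k => // l.
  have lip (v : 'rV[R]_2) (M : R) : `|v 0 0| + `|v 0 1| <= M ->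
      `|dot (direction t) v - dot (u k) v| <= M * delta.
    move=> vM; apply: le_trans (dot_direction_lipschitz _ _ _) _.
    by apply: ler_pM => //; rewrite addr_ge0.
  have := lip _ _ (rowB l).
  have xB : `|x k 0 0| + `|x k 0 1| <= B + 2.
    have := rowB (p k); rewrite !mxE /=.
    have := ler_normD (d (p k) 0) (cos (delta * k%:R)).
    have := ler_normD (d (p k) 1) (sin (delta * k%:R)).
    have : `|cos (delta * k%:R)| <= 1 by rewrite ler_norml cos_geN1 cos_le1.
    have : `|sin (delta * k%:R)| <= 1 by rewrite ler_norml sin_geN1 sin_le1.
    lra.
  have := lip _ _ xB; rewrite !ler_norml => /andP[h1 _] /andP[_ h2].
  have := (pP k).2 l; move: h1; rewrite [dot (u k) (x k)]dotDr.
  rewrite [dot (u k) (u k)]dot_directions subrr cos0; lra.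
suff : 2 * polygon_length hull_polygon <=
    2 * polygon_length (mkseq x N.+1) + (- 4 + 8 * (B + 1) * delta) * pi.
  have : C <= eps * N.+1%:R by rewrite mulrC -ler_pdivrMr.
  have : delta * N.+1%:R * (4 * (B + 1) * pi) = C by rewrite deltaN /C; ring.
  have N0 : 0 < N.+1%:R :> R by rewrite ltr0n.
  move=> e1 e2 e3.
  have : 4 * (B + 1) * delta * pi <= eps.
    by rewrite -(ler_pM2r N0); apply: le_trans e2; rewrite -e1; lra.
  lra.
rewrite !polygon_lengthE; apply: crofton_le => t t0 tpi.
rewrite -!cyclic_variation_dotE.
have [k kN kP] := near_dir t t0 ltac:(lra).
have [k' kN' kP'] := near_dir (t + pi) ltac:(lra) ltac:(lra).
have [i is_ imax] := hull_cycle_argmax (direction_neq0 t).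
have [j js jmax] := hull_cycle_argmax (direction_neq0 (t + pi)).
have xq l : (l <= N)%N -> x l \in mkseq x N.+1.
  by move=> lN; apply/map_f; rewrite mem_iota.
have := cyclic_variation_ge (dot (direction t)) (xq _ kN) (xq _ kN').
have := kP i; have := kP' j; rewrite !directionDpi => hj hi hv.
have mM : dot (direction t) (row j d) <= dot (direction t) (row i d).
  exact: imax.
suff : cyclic_variation (dot (direction t)) hull_polygon <=
    2 * (dot (direction t) (row i d) - dot (direction t) (row j d)) by lra.
apply: ccw_variation_le; [exact: hull_cycle_ccw|lra|].
move=> _ _ /mapP[a _ ->] /mapP[b _ ->].
by have := imax a; have := jmax b; rewrite !directionDpi; lra.
Qed.

Lemma Per_hull_cycle : Per d = Per_ext s d.
Proof.
have lenE : Per_ext s d = polygon_length hull_polygon + 2 * pi.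
  rewrite /Per_ext /polygon_length /hull_polygon; congr (_ + _).
  by rewrite cyclic_edges_map big_map.
rewrite lenE /Per /boundary_length; set S := [set l | _].
have Sub : ubound S (polygon_length hull_polygon + 2 * pi).
  by move=> _ [q [qK qP ->]]; exact: inscribed_length_le.
apply/eqP; rewrite eq_le; apply/andP; split.
  apply: ge_sup => //; have [q [qK qP _]] := inscribed_length_ge ltr01.
  by exists (polygon_length q), q.
apply/ler_addgt0Pr => e e0; have [q [qK qP qe]] := inscribed_length_ge e0.
apply: le_trans qe _; rewrite lerD2r; apply: ub_le_sup.
  by exists (polygon_length hull_polygon + 2 * pi).
by exists q.
Qed.

End Perimeter.

(** * Independence of the perimeter function from the chosen hull cycle *)

Section CyclicEdges.
Context {T : eqType}.
Implicit Types (p q x : T) (s : seq T).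

Lemma unzip1_cyclic_edges s : unzip1 (cyclic_edges s) = s.
Proof. by rewrite unzip1_zip// size_rot. Qed.

Lemma unzip2_cyclic_edges s : unzip2 (cyclic_edges s) = rot 1 s.
Proof. by rewrite unzip2_zip// size_rot. Qed.

Lemma mem_cyclic_edges s p q : (p, q) \in cyclic_edges s -> p \in s /\ q \in s.
Proof.
move=> pq; split; first by rewrite -(unzip1_cyclic_edges s); exact: (map_f fst pq).
by rewrite -(mem_rot 1) -(unzip2_cyclic_edges s); exact: (map_f snd pq).
Qed.

Lemma cyclic_edges_from s p : p \in s -> exists q, (p, q) \in cyclic_edges s.
Proof.
rewrite -{1}(unzip1_cyclic_edges s) => /mapP[[p' q] pq ->]; by exists q.
Qed.

Lemma cyclic_edges_loop s p : uniq s -> (p, p) \in cyclic_edges s -> s = [:: p].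
Proof.
case: s => // x [|y t] us; first by rewrite /cyclic_edges rot1_cons inE => /eqP[_ ->].
rewrite /cyclic_edges rot1_cons => /(nthP (p, p)); rewrite size1_zip; last first.
  by rewrite size_rcons.
case=> i ilt; rewrite nth_zip ?size_rcons// => -[pE].
rewrite -rcons_cons nth_rcons.
have [it|it|it] := ltngtP i (size (y :: t)).
- move=> e; have /eqP : nth p [:: x, y & t] i.+1 = nth p [:: x, y & t] i.
    by rewrite pE.
  by rewrite nth_uniq// => /eqP; lia.
- by move: it ilt => /=; lia.
- move=> e; have /eqP : nth p [:: x, y & t] 0 = nth p [:: x, y & t] i.
    by rewrite pE.
  by rewrite nth_uniq// it.
Qed.

End CyclicEdges.

Section HullClass.
Context {R : realType} {n : nat}.
Implicit Types (c d : 'M[R]_(n, 2)) (s : seq 'I_n).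

(** If the edges leaving [p] in the two cycles ended at different vertices, each end would lie
    strictly to the left of the other edge, against the antisymmetry of [orient]. *)
Lemma hull_cycle_edges_sub d s s' : packing d -> hull_cycle d s ->
  hull_cycle d s' -> {subset cyclic_edges s <= cyclic_edges s'}.
Proof.
move=> dP sP s'P [p q] pq; have [ps qs] := mem_cyclic_edges pq.
have [us sv _] := sP; have [us' sv' _] := s'P.
have ss' i : i \in s -> i \in s' by move/sv => ?; apply/sv'.
have s's i : i \in s' -> i \in s by move/sv' => ?; apply/sv.
have [q' pq'] := cyclic_edges_from (ss' _ ps).
have [_ qs'] := mem_cyclic_edges pq'.
have [->//|nqq'] := eqVneq q q'.
have [pqE|npq] := eqVneq p q.
  rewrite -pqE in pq nqq'.
  have sE := cyclic_edges_loop us pq.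
  by move: (s's _ qs') nqq'; rewrite {1}sE inE => /eqP ->; rewrite eqxx.
have [pqE|npq'] := eqVneq p q'.
  rewrite -pqE in pq' nqq'.
  have sE := cyclic_edges_loop us' pq'.
  by move: (ss' _ qs) nqq'; rewrite {1}sE inE => /eqP ->; rewrite eqxx.
have := hull_cycle_edge_gt0 dP sP pq ps qs (s's _ qs') npq npq' nqq'.
have := hull_cycle_edge_gt0 dP s'P pq' (ss' _ ps) qs' (ss' _ qs) npq' npq.
rewrite eq_sym => /(_ nqq'); rewrite orient_swap; lra.
Qed.

(** [same_hull] provides some common cycle, possibly another list than the one fixed in the theorem;
    this lemma passes between them. *)
Lemma Per_ext_hull_cycle d s s' c : packing d -> hull_cycle d s ->
  hull_cycle d s' -> Per_ext s c = Per_ext s' c.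
Proof.
move=> dP sP s'P; congr (_ + _); apply: perm_big; apply: uniq_perm.
- by apply: (@map_uniq _ _ fst); rewrite -/(unzip1 _) unzip1_cyclic_edges; case: sP.
- by apply: (@map_uniq _ _ fst); rewrite -/(unzip1 _) unzip1_cyclic_edges; case: s'P.
- move=> e; apply/idP/idP; first exact: (hull_cycle_edges_sub dP sP s'P).
  exact: (hull_cycle_edges_sub dP s'P sP).
Qed.

End HullClass.

(* For [n = 0] the hull is empty, [Per] is [0] and the [2 * pi] is wrong. *)
Lemma Per_hull_class (R : realType) (n : nat) (c : 'M[R]_(n, 2)) (s : seq 'I_n) :
  packing c -> hull_cycle c s ->
  exists k, forall d, hull_class c d -> Per d = Per_ext s d + k.
Proof.
move=> cP sP; case: n c s cP sP => [|m] c s cP sP.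
  by exists (Per c - Per_ext s c) => d _; rewrite (flatmx0 d) (flatmx0 c) subrKC.
exists 0 => d [dP [s' [s'c s'd]]].
by rewrite addr0 (Per_hull_cycle ord0 dP s'd); exact: (Per_ext_hull_cycle d cP s'c sP).
Qed.

(** * Second-order chain rule *)

Lemma near_eq_differentiable (R : numFieldType) (V W : normedModType R)
    (f g : V -> W) (x : V) :
  (\forall y \near x, f y = g y) -> differentiable f x -> differentiable g x.
Proof.
move=> fg df; have fgx := nbhs_singleton fg.
have [dfc /eqaddoP dfE] := iffLR (diff_locallyP _ _) df.
have cx : h + x @[h --> (0 : V)] --> x.
  by rewrite -[X in _ --> X]add0r; exact: (cvgD cvg_id (cvg_cst x)).
have gE : g \o shift x = cst (g x) + 'd f x +o_ 0 id.
  apply/eqaddoP => e e0; have h1 := dfE e e0; have h2 := cx _ fg.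
  near=> h.
  have fgh : f (h + x) = g (h + x) by near: h.
  have : `|(f \o shift x - (cst (f x) + 'd f x)) h| <= e * `|h| by near: h.
  by rewrite -[(f \o shift x - _) h]/(f (h + x) - (f x + 'd f x h)) fgh fgx.
have dgE := diff_unique dfc gE.
by apply/diff_locallyP; rewrite dgE.
Unshelve. all: by end_near. Qed.

Lemma is_derive_fsum (R : numFieldType) (V W : normedModType R) n
    (h : 'I_n -> V -> W) (x v : V) (dh : 'I_n -> W) :
  (forall i, is_derive x v (h i) (dh i)) ->
  is_derive x v (fun y => \sum_(i < n) h i y) (\sum_(i < n) dh i).
Proof.
move=> dhP; have -> : (fun y => \sum_(i < n) h i y) = \sum_(i < n) h i.
  by apply/funext => y; rewrite fct_sumE.
exact: is_derive_sum.
Qed.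

Lemma sum2D (R : nmodType) m n (F G H : 'I_m -> 'I_n -> R) :
  (forall i k, F i k + G i k = H i k) ->
  \sum_i \sum_k F i k + \sum_i \sum_k G i k = \sum_i \sum_k H i k.
Proof.
move=> FGH; rewrite -big_split; apply: eq_bigr => i _.
by rewrite -big_split; apply: eq_bigr => k _; exact: FGH.
Qed.

Section C2At.
Context {R : realType} {m n : nat}.
Local Notation V := 'M[R]_(m, n).
Implicit Types (f g : V -> R) (c u v a : V).

(** Evaluating the differential at a fixed vector keeps the second-order condition about scalar
    functions. *)
Definition C2_at f c : Prop :=
  (\forall y \near c, differentiable f y) /\
  forall u, differentiable (fun y => 'd f y u : R) c.

Lemma C2_at_cst (k : R) c : C2_at (cst k) c.
Proof.
split=> [|u]; first by near=> y; exact: differentiable_cst.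
have -> : (fun y : V => 'd (cst k) y u : R) = cst 0.
  by apply/funext => y; rewrite diff_cst.
exact: differentiable_cst.
Unshelve. all: by end_near. Qed.

Lemma diff_sum_delta f y u :
  'd f y u = \sum_(i < m) \sum_(k < n) u i k * 'd f y (delta_mx i k).
Proof.
rewrite [in LHS](matrix_sum_delta u) linear_sum; apply: eq_bigr => i _.
by rewrite linear_sum; apply: eq_bigr => k _; rewrite linearZ.
Qed.

Lemma D2_sum_delta f c u v : C2_at f c ->
  D2 f c u v = \sum_(i < m) \sum_(k < n) u i k * D2 f c (delta_mx i k) v.
Proof.
move=> [_ fC].
have dfu w : is_derive c v (fun y => 'd f y w : R) (D2 f c w v).
  have dw := fC w.
  apply: DeriveDef; first exact: diff_derivable.
  exact: deriveE.
have dE : is_derive c v (fun y => 'd f y u : R)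
    (\sum_(i < m) \sum_(k < n) u i k *: D2 f c (delta_mx i k) v).
  under eq_fun do rewrite diff_sum_delta.
  by do 2 apply: is_derive_fsum => ?.
by have [_ <-] := dfu u; have [_ <-] := dE.
Qed.

(** In ['d f (gam t) (derive1 gam t)] both the point and the vector move; expanding over [delta_mx]
    gives a sum of products of scalar functions, to which the product rule applies. *)
Lemma C2_at_curve f (gam : R -> V) c v a :
  C2_at f c -> gam 0 = c -> derive1 gam 0 = v ->
  (\forall t \near (0 : R), derivable gam t 1) ->
  is_derive (0 : R) 1 (derive1 gam) a ->
  (\forall t \near (0 : R), derivable (f \o gam) t 1) /\
  is_derive (0 : R) 1 (derive1 (f \o gam)) (D2 f c v v + 'd f c a).
Proof.
move=> fC g0 g1 dgam [d2gam g2].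
have [df d2f] := fC.
have dgam0 : derivable gam 0 1 := nbhs_singleton dgam.
have cgam : {for 0, continuous gam}.
  exact/differentiable_continuous/derivable1_diffP.
have dfgam : \forall t \near (0 : R), differentiable f (gam t).
  by apply: (cgam [set y | differentiable f y]); rewrite g0.
have dcomp : \forall t \near (0 : R), derivable (f \o gam) t 1.
  near=> t; apply/derivable1_diffP; apply: differentiable_comp.
    by apply/derivable1_diffP; near: t.
  by near: t.
split=> //.
apply: (@near_eq_is_derive _ _ _ (fun t => \sum_(i < m) \sum_(k < n)
    derive1 gam t i k * 'd f (gam t) (delta_mx i k))).
  near=> t.
  have dgt : differentiable gam t by apply/derivable1_diffP; near: t.
  have dft : differentiable f (gam t) by near: t.
  have dfgt := differentiable_comp dgt dft.
  transitivity ('d f (gam t) (derive1 gam t) : R).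
    by rewrite [RHS]diff_sum_delta.
  by rewrite (derive1E' dgt) (derive1E' dfgt) (diff_comp dgt dft).
have e1 := D2_sum_delta v v fC; have e2 := diff_sum_delta f c a.
have -> : D2 f c v v + 'd f c a = \sum_(i < m) \sum_(k < n)
    (derive1 gam 0 i k *: D2 f c (delta_mx i k) v +
     ('d f (gam 0) (delta_mx i k) : R) *: a i k).
  apply: etrans (congr2 +%R e1 e2) _.
  apply: sum2D => i k.
  by rewrite g0 g1; congr (_ + _); exact: mulrC.
apply: is_derive_fsum => i; apply: is_derive_fsum => k.
apply: is_deriveM.
  have dik := iffLR (derivable_mxP _ _ _) d2gam i k.
  apply: DeriveDef; first exact: dik.
  by move/matrixP : (derive_mx d2gam) => /(_ i k); rewrite g2 mxE => ->.
have dgd : differentiable (fun y => 'd f y (delta_mx i k) : R) (gam 0).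
  by rewrite g0; exact: d2f.
have dg0 : differentiable gam 0 by exact/derivable1_diffP.
have dcomp' := differentiable_comp dg0 dgd.
apply: DeriveDef; first exact/diff_derivable.
apply: etrans (deriveE _ dcomp') _; rewrite (diff_comp dg0 dgd).
rewrite -[LHS]/('d (fun y => 'd f y (delta_mx i k) : R) (gam 0) ('d gam 0 1)).
by rewrite -(derive1E' dg0) g1 g0.
Unshelve. all: by end_near. Qed.

End C2At.

Lemma is_derive_coord (R : realType) m n (y u : 'M[R]_(m, n)) i k :
  is_derive y u (fun z : 'M[R]_(m, n) => z i k : R) (u i k).
Proof.
have dy := differentiable_coord y i k.
apply: DeriveDef; first exact: diff_derivable.
have did : derivable (id : _ -> 'M[R]_(m, n)) y u by exact: derivable_id.
have := derive_mx did; rewrite derive_id => /matrixP/(_ i k).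
by rewrite mxE => ->.
Qed.

Lemma C2_atD (R : realType) m n (f g : 'M[R]_(m, n) -> R) c :
  C2_at f c -> C2_at g c -> C2_at (f + g) c.
Proof.
move=> [df d2f] [dg d2g]; split.
  near=> y; apply: differentiableD; by near: y.
move=> u; have duv := differentiableD (d2f u) (d2g u).
apply: near_eq_differentiable duv; near=> y.
have dfy : differentiable f y by near: y.
have dgy : differentiable g y by near: y.
exact: (esym (congr1 (fun h : 'M[R]_(m, n) -> R => h u) (diffD dfy dgy))).
Unshelve. all: by end_near. Qed.

Lemma C2_at_sum (R : realType) m n (I : Type) (r : seq I)
    (F : I -> 'M[R]_(m, n) -> R) c :
  (forall i, C2_at (F i) c) ->
  C2_at (fun y => \sum_(i <- r) F i y) c.
Proof.
move=> FC; elim: r => [|i r IHr].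
  have -> : (fun y => \sum_(i <- [::]) F i y) = cst 0.
    by apply/funext => y; rewrite big_nil.
  exact: C2_at_cst.
have -> : (fun y => \sum_(j <- i :: r) F j y) = F i + (fun y => \sum_(j <- r) F j y).
  by apply/funext => y; rewrite big_cons.
exact: (C2_atD (FC i) IHr).
Qed.

Section Distance.
Context {R : realType} {n : nat} (p q : 'I_n).
Local Notation V := 'M[R]_(n, 2).
Implicit Types (c y u v : V).

Let D k y : R := y q k - y p k.

Let Q y : R := D 0 y ^+ 2 + D 1 y ^+ 2.

Let F y : R := enorm (row q y - row p y).

Let dD k y u : is_derive y u (D k) (D k u).
Proof. exact: (is_deriveB (is_derive_coord y u q k) (is_derive_coord y u p k)). Qed.

Let diffD k y : differentiable (D k) y.
Proof.
exact: (differentiableB (differentiable_coord y q k) (differentiable_coord y p k)).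
Qed.

Let dQ y u : is_derive y u Q (2 * (D 0 y * D 0 u + D 1 y * D 1 u)).
Proof.
have h := is_deriveD (is_deriveM (dD 0 y u) (dD 0 y u))
  (is_deriveM (dD 1 y u) (dD 1 y u)).
have -> : Q = D 0 * D 0 + D 1 * D 1 by apply/funext => z; rewrite /Q !expr2.
by apply: (is_derive_eq h); rewrite /GRing.scale /=; ring.
Qed.

Let diffQ y : differentiable Q y.
Proof.
have -> : Q = D 0 * D 0 + D 1 * D 1 by apply/funext => z; rewrite /Q !expr2.
exact: (differentiableD (differentiableM (diffD 0 y) (diffD 0 y))
  (differentiableM (diffD 1 y) (diffD 1 y))).
Qed.

Let FE : F = Num.sqrt \o Q.
Proof. by apply/funext => y; rewrite /F /enorm dotE !mxE. Qed.

Let diffF y : 0 < Q y -> differentiable F y.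
Proof.
move=> Qy; rewrite FE; apply: differentiable_comp; first exact: diffQ.
have [d _] := is_derive1_sqrt Qy; exact/derivable1_diffP.
Qed.

Lemma diff_distance y u : 0 < Q y ->
  'd F y u = (F y)^-1 * (D 0 y * D 0 u + D 1 y * D 1 u) :> R.
Proof.
move=> Qy; have [d dE] := is_derive1_sqrt Qy.
have ds : differentiable Num.sqrt (Q y) by exact/derivable1_diffP.
rewrite {1}FE (diff_comp (diffQ y) ds).
rewrite -[LHS]/('d Num.sqrt (Q y) ('d Q y u)) -(deriveE u (diffQ y)).
have [_ ->] := dQ y u.
rewrite (deriv1E d) /= derive1E dE FE /= /GRing.scale /= invfM.
by field; rewrite sqrtr_eq0 -ltNge.
Qed.

Lemma diff_distance_sqr (k : R) y u :
  'd (fun z => F z ^+ 2 - k) y u = 2 * (D 0 y * D 0 u + D 1 y * D 1 u) :> R.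
Proof.
have -> : (fun z => F z ^+ 2 - k) = Q - cst k.
  by apply/funext => z; rewrite /F sqr_enorm dotE !mxE -!expr2.
have dk : differentiable (cst k) y := differentiable_cst _ _.
apply: etrans (esym (deriveE u (differentiableB (diffQ y) dk))) _.
have [_ e] := is_deriveB (dQ y u) (is_derive_cst k y u).
by apply: etrans e _; rewrite subr0.
Qed.

(** The case [p = q] serves the degenerate edge of a one-vertex hull: the length is identically 0,
    although the square root is singular there. *)
Lemma C2_at_distance c : p = q \/ 0 < F c -> C2_at F c.
Proof.
case=> [pq|Fc].
  have -> : F = cst 0.
    by apply/funext => y; rewrite /F pq subrr /enorm dotE !mxE mulr0 addr0 sqrtr0.
  exact: C2_at_cst.
have Qc : 0 < Q c by rewrite -sqrtr_gt0; move: Fc; rewrite FE.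
have Qnear : \forall y \near c, 0 < Q y.
  have cQ : {for c, continuous Q} := differentiable_continuous (diffQ c).
  by apply: (cQ [set r | 0 < r]); exact: lt_nbhsr.
split; first by near=> y; apply: diffF; near: y.
move=> u.
pose G : V -> R := (fun y => (F y)^-1) * (D 0 u *: D 0 + D 1 u *: D 1).
have dG : differentiable G c.
  apply: differentiableM.
    have F0 : F c != 0 by rewrite gt_eqF.
    exact: (differentiableV (diffF Qc) F0).
  exact: (differentiableD (differentiableZ _ (diffD 0 c))
    (differentiableZ _ (diffD 1 c))).
apply: near_eq_differentiable dG; near=> y.
have Qy : 0 < Q y by near: y.
apply: etrans _ (esym (diff_distance u Qy)).
rewrite -[LHS]/((F y)^-1 * (D 0 u * D 0 y + D 1 u * D 1 y)).
by rewrite (mulrC (D 0 u)) (mulrC (D 1 u)).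
Unshelve. all: by end_near. Qed.

End Distance.

(** * Curves in the linkage as power series *)

Section PowerSeries.
Context {R : realType}.
Implicit Types (x z : nat -> R) (M r t : R).

Definition geometric_bound x r : Prop := exists M, forall k, `|x k| <= M * r ^+ k.

Definition power_sum x t : R := limn (pseries x t).

(** The derivative brings a factor [k.+1 <= 2 ^ k], paid for by doubling the rate. *)
Lemma geometric_bound_diffs x r : 0 <= r -> geometric_bound x r ->
  geometric_bound (pseries_diffs x) (2 * r).
Proof.
move=> r0 [M xM]; exists (M * r) => k.
rewrite /pseries_diffs normrM ger0_norm//.
have Mk : 0 <= M * r ^+ k.+1 := le_trans (normr_ge0 _) (xM k.+1).
rewrite (_ : M * r * _ = 2 ^+ k * (M * r ^+ k.+1)); last first.
  by rewrite exprMn exprS; ring.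
apply: ler_pM => //; rewrite -natrX ler_nat; exact: ltn_expl.
Qed.

Lemma cvg_pseries_geometric x r t : 0 <= r -> geometric_bound x r ->
  `|t| * r < 1 -> cvgn (pseries x t).
Proof.
move=> r0 [M xM] tr; apply: normed_cvg.
apply: (@series_le_cvg _ _ (geometric `|M| (`|t| * r))).
- by move=> n; exact: normr_ge0.
- by move=> n; rewrite /geometric /= mulr_ge0// exprn_ge0// mulr_ge0.
- move=> n; rewrite /geometric /= normrM normrX.
  rewrite (_ : `|M| * _ = `|M| * r ^+ n * `|t| ^+ n); last by rewrite exprMn; ring.
  rewrite ler_wpM2r ?exprn_ge0//; apply: le_trans (xM n) _.
  by rewrite ler_wpM2r ?exprn_ge0// ler_norm.
- apply: is_cvg_geometric_series; rewrite ger0_norm// mulr_ge0//.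
Qed.

Lemma is_derive_power_sum x r t : 0 < r -> geometric_bound x r ->
  `|t| * (4 * r) < 1 ->
  is_derive t 1 (power_sum x) (power_sum (pseries_diffs x) t).
Proof.
move=> r0 xr tr; have r4 : 0 < 4 * r by lra.
(* Term-by-term differentiation needs a point beyond [t] where the series and its first two formal
   derivatives converge. The second has rate [4 * r], so the midpoint between [|t|] and
   [1 / (4 * r)] works. *)
pose K := (`|t| + (4 * r)^-1) / 2.
have tK : `|t| < (4 * r)^-1 by rewrite -[_^-1]mul1r ltr_pdivlMr.
have K0 : 0 <= K by rewrite /K; have := normr_ge0 t; lra.
have Kr : K * (4 * r) < 1.
  by rewrite -ltr_pdivlMr// mul1r /K; lra.
have xr2 := geometric_bound_diffs (ltW r0) xr.
have xr4 : geometric_bound _ _ :=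
  geometric_bound_diffs (mulr_ge0 (ler0n _ 2) (ltW r0)) xr2.
apply: (@pseries_snd_diffs _ x K).
- by apply: (cvg_pseries_geometric _ xr); rewrite ?ger0_norm//; nra.
- by apply: (cvg_pseries_geometric _ xr2); rewrite ?ger0_norm//; nra.
- by apply: (cvg_pseries_geometric _ xr4); rewrite ?ger0_norm//; nra.
- by rewrite [ltRHS]ger0_norm// /K; lra.
Qed.

Lemma power_sum0 x : power_sum x 0 = x 0%N.
Proof.
apply: cvg_lim => //; rewrite -cvg_shiftS /=.
have -> : (fun n => pseries x 0 n.+1) = cst (x 0%N).
  apply/funext => n; rewrite /pseries /series /= big_nat_recl//= expr0 mulr1.
  by rewrite big1 ?addr0// => i _; rewrite expr0n mulr0.
exact: cvg_cst.
Qed.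

(* The square of a partial sum has the coefficients of the full Cauchy square
   below degree [N]; the others contribute at most a multiple of [2^-N]. *)
Lemma power_sum_sqrD x z r (k0 t : R) : 0 < r ->
  geometric_bound x r -> geometric_bound z r ->
  (forall k, \sum_(i < k.+1) (x i * x (k - i)%N + z i * z (k - i)%N) =
     if k is 0%N then k0 else 0) ->
  8 * r * `|t| <= 1 ->
  power_sum x t ^+ 2 + power_sum z t ^+ 2 = k0.
Proof.
move=> r0 xr zr conv tr.
have rk k : 0 <= r ^+ k by rewrite exprn_ge0// ltW.
have xc : cvgn (pseries x t) by apply: (cvg_pseries_geometric _ xr); [exact: ltW|lra].
have zc : cvgn (pseries z t) by apply: (cvg_pseries_geometric _ zr); [exact: ltW|lra].
have [M [M0 xM zM]] : exists M, [/\ 0 <= M, forall k, `|x k| <= M * r ^+ k &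
    forall k, `|z k| <= M * r ^+ k].
  case: xr => M1 h1; case: zr => M2 h2; exists (`|M1| + `|M2|); split.
  - by rewrite addr_ge0.
  - move=> k; apply: le_trans (h1 k) _; rewrite ler_wpM2r ?rk//.
    by have := ler_norm M1; have := normr_ge0 M2; lra.
  - move=> k; apply: le_trans (h2 k) _; rewrite ler_wpM2r ?rk//.
    by have := ler_norm M2; have := normr_ge0 M1; lra.
have err N : `|pseries x t N.+1 ^+ 2 + pseries z t N.+1 ^+ 2 - k0| <=
    geometric (2 * M ^+ 2) 2^-1 N.
  pose X := \poly_(i < N.+1) x i; pose Z := \poly_(i < N.+1) z i.
  have XE : X.[t] = pseries x t N.+1.
    by rewrite horner_poly /pseries /series /= big_mkord.
  have ZE : Z.[t] = pseries z t N.+1.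
    by rewrite horner_poly /pseries /series /= big_mkord.
  pose P := X * X + Z * Z - k0%:P.
  have PE : P.[t] = pseries x t N.+1 ^+ 2 + pseries z t N.+1 ^+ 2 - k0.
    by rewrite !hornerE XE ZE !expr2.
  have sqr_bound (Y : {poly R}) k : (forall j, `|Y`_j| <= M * r ^+ j) ->
      `|(Y * Y)`_k| <= k.+1%:R * (M ^+ 2 * r ^+ k).
    move=> YM; rewrite coefM; apply: le_trans (ler_norm_sum _ _ _) _.
    have -> : k.+1%:R * (M ^+ 2 * r ^+ k) = \sum_(j < k.+1) M ^+ 2 * r ^+ k.
      by rewrite sumr_const card_ord mulr_natl.
    apply: ler_sum => j _; rewrite normrM.
    have jk : (j <= k)%N by rewrite -ltnS.
    apply: le_trans (ler_pM _ _ (YM _) (YM _)) _ => //.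
    by rewrite -[in leRHS](subnKC jk) exprD expr2 mulrACA.
  have trunc (y : nat -> R) : (forall k, `|y k| <= M * r ^+ k) ->
      forall j, `|(\poly_(i < N.+1) y i)`_j| <= M * r ^+ j.
    move=> yM j; rewrite coef_poly; case: ifP => // _.
    by rewrite normr0 mulr_ge0// exprn_ge0// ltW.
  have Plow k : (k <= N)%N -> P`_k = 0.
    move=> kN; rewrite coefB coefD !coefM coefC -big_split /=.
    rewrite (_ : \sum_(i < k.+1) _ = if k is 0%N then k0 else 0).
      by case: k kN => [|k] _ /=; rewrite subrr.
    rewrite -conv; apply: eq_bigr => i _; rewrite !coef_poly.
    by rewrite !ltnS (leq_trans (leq_subr _ _) kN) (leq_trans _ kN)// -ltnS.
  have Phigh k : (N < k)%N -> `|P`_k| <= 2 * (k.+1%:R * (M ^+ 2 * r ^+ k)).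
    move=> kN; rewrite coefB coefC (gtn_eqF (leq_ltn_trans (leq0n N) kN)) subr0.
    rewrite coefD; apply: le_trans (ler_normD _ _) _.
    by have := sqr_bound X k (trunc _ xM); have := sqr_bound Z k (trunc _ zM); lra.
  have sP : (size P <= N.*2.+2)%N.
    rewrite (leq_trans (size_polyD _ _))// geq_max size_polyN.
    rewrite (leq_trans (size_polyC_leq1 _))// andbT.
    rewrite (leq_trans (size_polyD _ _))// geq_max.
    have sq (Y : {poly R}) : (size Y <= N.+1)%N -> (size (Y * Y)%R <= N.*2.+2)%N.
      by move=> sY; apply: leq_trans (size_polyMleq _ _) _; lia.
    by rewrite !sq// size_poly.
  rewrite -PE (horner_coef_wide _ sP); apply: le_trans (ler_norm_sum _ _ _) _.
  (* Since [r * |t| <= 1/8], the term of degree [i > N] is at most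
     [2 M^2 (i + 1) / 8^i <= 2 M^2 / 4^i], and there are at most [2 N + 2] terms. *)
  apply: (@le_trans _ _ (\sum_(i < N.*2.+2) 2 * M ^+ 2 * 4^-1 ^+ N.+1)).
    apply: ler_sum => i _; have [iN|iN] := leqP i N.
      rewrite Plow// mul0r normr0 mulr_ge0 ?exprn_ge0 ?mulr_ge0 ?exprn_ge0//.
    rewrite normrM normrX.
    apply: le_trans (ler_wpM2r _ (Phigh _ iN)) _; first exact: exprn_ge0.
    apply: (@le_trans _ _ (2 * M ^+ 2 * 4^-1 ^+ i)); last first.
      rewrite ler_wpM2l ?mulr_ge0 ?exprn_ge0//.
      by rewrite ler_wiXn2l// invf_le1 ?ler1n.
    have -> : 2 * (i.+1%:R * (M ^+ 2 * r ^+ i)) * `|t| ^+ i =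
        2 * M ^+ 2 * (i.+1%:R * (r ^+ i * `|t| ^+ i)) by ring.
    rewrite ler_wpM2l ?mulr_ge0 ?exprn_ge0//.
    apply: (@le_trans _ _ (2 ^+ i * (r * `|t|) ^+ i)).
      rewrite exprMn ler_wpM2r ?mulr_ge0 ?rk ?exprn_ge0//.
      by rewrite -natrX ler_nat; exact: ltn_expl.
    rewrite -exprMn lerXn2r ?nnegrE//; first by rewrite !mulr_ge0// ltW.
    by lra.
  rewrite sumr_const card_ord -[leLHS]mulr_natl -[leRHS]/(2 * M ^+ 2 * 2^-1 ^+ N).
  have N2 : N.+1%:R <= 2 ^+ N :> R by rewrite -natrX ler_nat; exact: ltn_expl.
  have -> : N.*2.+2%:R = 2 * N.+1%:R :> R by rewrite -natrM mul2n doubleS.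
  have -> : 4^-1 ^+ N.+1 = 4^-1 * (2^-1 ^+ N * 2^-1 ^+ N) :> R.
    rewrite exprS -exprMn; congr (_ * _ ^+ _); lra.
  have e : 2 ^+ N * 2^-1 ^+ N = 1 :> R by rewrite -exprMn divff// expr1n.
  have h0 : 0 <= 2^-1 ^+ N :> R by rewrite exprn_ge0.
  have M2 : 0 <= M ^+ 2 by rewrite exprn_ge0.
  have : N.+1%:R * 2^-1 ^+ N <= 1 :> R.
    by apply: le_trans (ler_wpM2r h0 N2) _; rewrite e.
  have : 0 <= M ^+ 2 * 2^-1 ^+ N by rewrite mulr_ge0.
  nra.
have errc : (fun N => pseries x t N.+1 ^+ 2 + pseries z t N.+1 ^+ 2 - k0) @ \oo -->
    power_sum x t ^+ 2 + power_sum z t ^+ 2 - k0.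
  have h (y : nat -> R) : cvgn (pseries y t) ->
      (fun N => pseries y t N.+1 ^+ 2) @ \oo --> power_sum y t ^+ 2.
    move=> yc; have {}yc : (fun N => pseries y t N.+1) @ \oo --> power_sum y t.
      by rewrite (@cvg_shiftS _ (pseries y t)).
    exact: (cvgM yc yc).
  exact: (cvgB (cvgD (h _ xc) (h _ zc)) (cvg_cst k0)).
have err0 : (fun N => pseries x t N.+1 ^+ 2 + pseries z t N.+1 ^+ 2 - k0) @ \oo --> 0.
  have g0 : geometric (2 * M ^+ 2) 2^-1 @ \oo --> (0 : R).
    by apply: cvg_geometric; rewrite ger0_norm// invf_lt1 ?ltr1n.
  apply: norm_cvg0; apply: (squeeze_cvgr _ (cvg_cst 0) g0).
  by near=> N; apply/andP; split; [exact: normr_ge0 | exact: err].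
by apply/eqP; rewrite -subr_eq0; apply/eqP; exact: (cvg_unique _ errc err0).
Unshelve. all: by end_near. Qed.

End PowerSeries.

(** The step receives the whole history, because a convolution involves all earlier coefficients. *)
Lemma strong_recursion (T : Type) (x0 : T) (step : seq T -> T) :
  exists w : nat -> T, w 0%N = x0 /\ forall k, w k.+1 = step (mkseq w k.+1).
Proof.
pose hist := fix hist k :=
  if k is k'.+1 then rcons (hist k') (step (hist k')) else [:: x0].
pose w k := last x0 (hist k).
have histE k : hist k = mkseq w k.+1.
  elim: k => // k IHk; rewrite [LHS]/= -[X in _ = mkseq _ X]addn1 /mkseq iotaD map_cat.
  by rewrite cats1 -/(mkseq _ _) -IHk add0n /w /= last_rcons.
by exists w; split=> // k; rewrite -histE /w /= last_rcons.
Qed.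

(** * Growth of convolution recursions *)

Section Growth.
Context {R : realType}.

(** The induction runs on a bound with a subtracted reciprocal, which telescopes. *)
Lemma sum_inv_sqr_le (n : nat) : \sum_(i < n) (i.+1%:R ^- 2) <= 2 :> R.
Proof.
suff : \sum_(i < n.+1) (i.+1%:R ^- 2) <= 2 - n.+1%:R^-1 :> R.
  rewrite big_ord_recr /= => h.
  apply: (@le_trans _ _ (2 - n.+1%:R^-1)); last by rewrite gerBl invr_ge0.
  by apply: le_trans h; rewrite lerDl invr_ge0 exprn_ge0.
elim: n => [|n IHn]; first by rewrite big_ord1 expr1n invr1; lra.
rewrite big_ord_recr /=; apply: le_trans (lerD IHn (lexx _)) _.
have a0 : 0 < n.+1%:R :> R by rewrite ltr0n.
have -> : n.+2%:R = n.+1%:R + 1 :> R by rewrite natr1.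
set a := n.+1%:R in a0 *.
rewrite -subr_ge0.
have -> : 2 - (a + 1)^-1 - (2 - a^-1 + (a + 1) ^- 2) = (a * (a + 1) ^+ 2)^-1.
  by field; rewrite !gt_eqF//; lra.
rewrite invr_ge0 mulr_ge0 ?exprn_ge0//; lra.
Qed.

(** With [a + b = k + 2], the inequality [(a + b)^2 <= 2 (a^2 + b^2)] bounds each term by
    [2 / (k + 2)^2] times [1 / a^2 + 1 / b^2]; both resulting sums are at most 2, whence 8. *)
Lemma sum_inv_sqr_conv (k : nat) :
  \sum_(i < k.+1) (i.+1%:R ^- 2 * (k - i).+1%:R ^- 2) <= 8 / k.+2%:R ^+ 2 :> R.
Proof.
have k0 : 0 < k.+2%:R :> R by rewrite ltr0n.
have rev : \sum_(i < k.+1) (k - i).+1%:R ^- 2 = \sum_(i < k.+1) i.+1%:R ^- 2 :> R.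
  rewrite [RHS](reindex_inj rev_ord_inj); apply: eq_bigr => i _ /=.
  by rewrite subSS.
apply: (@le_trans _ _ (\sum_(i < k.+1)
    (2 / k.+2%:R ^+ 2 * (i.+1%:R ^- 2 + (k - i).+1%:R ^- 2)))).
  apply: ler_sum => i _.
  have ik : (i <= k)%N by rewrite -ltnS.
  have e : k.+2%:R = i.+1%:R + (k - i).+1%:R :> R.
    by rewrite -natrD; congr _%:R; lia.
  rewrite e; have : 0 < i.+1%:R :> R by rewrite ltr0n.
  have : 0 < (k - i).+1%:R :> R by rewrite ltr0n.
  move: (i.+1%:R : R) ((k - i).+1%:R : R) => a b b0 a0.
  rewrite -subr_ge0.
  have -> : 2 / (a + b) ^+ 2 * (a ^- 2 + b ^- 2) - a ^- 2 * b ^- 2 =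
      ((a - b) / (a * b * (a + b))) ^+ 2.
    by field; rewrite !gt_eqF//; lra.
  exact: sqr_ge0.
rewrite -mulr_sumr big_split /= rev.
have := sum_inv_sqr_le k.+1; set S := \sum_(i < _) _ => S2.
have : 0 <= (k.+2%:R ^+ 2)^-1 :> R by rewrite invr_ge0 exprn_ge0.
by move: S S2 ((_ ^+ 2)^-1) => S S2 a a0; nra.
Qed.

(* Majorant for a Catalan-type recursion: the weight [1 / (k + 1)^2] is stable
   under convolution up to a constant. *)
Lemma quadratic_recursion_growth (b : nat -> R) (C : R) : 0 < C ->
  (forall k, 0 <= b k) ->
  (forall k, b k.+1 <= C * \sum_(i < k.+1) b i * b (k - i)%N) ->
  exists r, 0 < r /\ geometric_bound b r.
Proof.
move=> C0 b0 brec; pose M := b 0%N + 1.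
have M0 : 0 < M by have := b0 0%N; rewrite /M; lra.
(* The 8 is the convolution constant, [C] comes from the recursion, and [M] is the extra factor left
   by a product of two bounds. *)
pose r := 8 * C * M.
have r0 : 0 < r by rewrite !mulr_gt0.
have bP k : b k <= M * r ^+ k * k.+1%:R ^- 2.
  elim/ltn_ind: k => -[|k] IHk.
    by rewrite expr0 expr1n invr1 !mulr1 /M; lra.
  apply: le_trans (brec k) _.
  apply: (@le_trans _ _ (C * (M ^+ 2 * r ^+ k * \sum_(i < k.+1)
      (i.+1%:R ^- 2 * (k - i).+1%:R ^- 2)))).
    rewrite ler_wpM2l ?(ltW C0)// mulr_sumr; apply: ler_sum => i _.
    have ik : (i <= k)%N by rewrite -ltnS.
    have h1 := IHk i (ltn_ord i).
    have h2 := IHk (k - i)%N (leq_subr i k : (k - i < k.+1)%N).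
    apply: le_trans (ler_pM (b0 _) (b0 _) h1 h2) _.
    have -> : r ^+ k = r ^+ i * r ^+ (k - i) by rewrite -exprD subnKC.
    by rewrite le_eqVlt; apply/orP; left; apply/eqP; ring.
  have CM : 0 <= C * (M ^+ 2 * r ^+ k).
    by rewrite mulr_ge0 ?mulr_ge0 ?exprn_ge0// ltW.
  rewrite mulrA; apply: (@le_trans _ _ (C * (M ^+ 2 * r ^+ k) * (8 / k.+2%:R ^+ 2))).
    by rewrite ler_wpM2l// sum_inv_sqr_conv.
  rewrite [r ^+ k.+1]exprS le_eqVlt; apply/orP; left; apply/eqP.
  by move: (r ^+ k) (k.+2%:R ^+ 2)^-1 => y a; rewrite /r; ring.
exists r; split=> //; exists M => k; rewrite ger0_norm//.
apply: le_trans (bP k) _; rewrite ler_piMr//.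
  by rewrite mulr_ge0 ?exprn_ge0// ltW.
by rewrite invf_le1 ?exprn_gt0 ?ltr0n// -natrX ler1n expn_gt0.
Qed.

End Growth.

(** [a q] represents, for the entrywise pairing, the coordinate functional of [g q] in the free
    family; its entries are the values on the [delta_mx]. *)
Lemma free_dual (K : fieldType) m n (T : eqType) (s : seq T)
    (g : T -> 'M[K]_(m, n)) : uniq s -> free [seq g p | p <- s] ->
  exists a : T -> 'M[K]_(m, n), forall p q, p \in s -> q \in s ->
    \sum_i \sum_k a q i k * g p i k = (p == q)%:R.
Proof.
move=> us gfree; pose X := in_tuple [seq g p | p <- s].
have sX : size [seq g p | p <- s] = size s by rewrite size_map.
pose cf q (w : 'M[K]_(m, n)) : K :=
  if insub (index q s) is Some j then coord X j w else 0.
exists (fun q => \matrix_(i, k) cf q (delta_mx i k)) => p q ps qs.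
have jq : (index q s < size [seq g p | p <- s])%N by rewrite sX index_mem.
have ip : (index p s < size [seq g p | p <- s])%N by rewrite sX index_mem.
have cfE w : cf q w = coord X (Ordinal jq) w by rewrite /cf insubT.
transitivity (coord X (Ordinal jq) (g p)).
  rewrite [in RHS](matrix_sum_delta (g p)) linear_sum; apply: eq_bigr => i _.
  rewrite linear_sum; apply: eq_bigr => k _.
  by rewrite linearZ !mxE cfE mulrC.
have -> : g p = X`_(Ordinal ip) by rewrite /= (nth_map p) ?index_mem// nth_index.
rewrite coord_free//; congr ((nat_of_bool _)%:R).
rewrite -val_eqE /=; apply/idP/idP => [/eqP pq|/eqP->]; last exact: eqxx.
by rewrite -(nth_index p ps) pq nth_index.
Qed.

Section MatrixSeries.
Context {R : realType} {m n : nat}.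
Local Notation V := 'M[R]_(m, n).
Implicit Types (Y : nat -> V) (r t : R).

Lemma norm_coord_le (w : V) i k : `|w i k| <= `|w|.
Proof.
rewrite [leRHS]/Num.Def.normr/= mx_normrE.
exact: (le_bigmax _ (fun ij => `|w ij.1 ij.2|) (i, k)).
Qed.

Definition entries_bounded Y r : Prop :=
  forall i k, geometric_bound (fun l => Y l i k) r.

Definition matrix_sum Y t : V := \matrix_(i, k) power_sum (fun l => Y l i k) t.

Definition matrix_diffs Y (l : nat) : V := l.+1%:R *: Y l.+1.

Lemma entries_bounded_diffs Y r : 0 <= r -> entries_bounded Y r ->
  entries_bounded (matrix_diffs Y) (2 * r).
Proof.
move=> r0 YB i k; have := geometric_bound_diffs r0 (YB i k).
by congr geometric_bound; apply/funext => l; rewrite !mxE.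
Qed.

Lemma is_derive_matrix_sum Y r t : 0 < r -> entries_bounded Y r ->
  `|t| * (4 * r) < 1 ->
  is_derive t 1 (matrix_sum Y) (matrix_sum (matrix_diffs Y) t).
Proof.
move=> r0 YB tr.
have d i k : is_derive t 1 (fun s => matrix_sum Y s i k)
    (matrix_sum (matrix_diffs Y) t i k).
  have -> : (fun s => matrix_sum Y s i k) = power_sum (fun l => Y l i k).
    by apply/funext => s; rewrite mxE.
  have := is_derive_power_sum r0 (YB i k) tr.
  rewrite mxE; congr (is_derive _ _ _ (power_sum _ _)).
  by apply/funext => l; rewrite !mxE.
have dY : derivable (matrix_sum Y) t 1.
  by apply/derivable_mxP => i k; have [] := d i k.
apply: DeriveDef => //; rewrite derive_mx//; apply/matrixP => i k.
by rewrite !mxE; have [_] := d i k; rewrite mxE.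
Qed.

Lemma matrix_sum0 Y : matrix_sum Y 0 = Y 0%N.
Proof. by apply/matrixP => i k; rewrite mxE power_sum0. Qed.

Lemma matrix_sum_C2 Y r : 0 < r -> entries_bounded Y r ->
  C2_on (- (32 * r)^-1) (32 * r)^-1 (matrix_sum Y) /\
  derive1 (matrix_sum Y) 0 = Y 1%N.
Proof.
move=> r0 YB.
have YB2 := entries_bounded_diffs (ltW r0) YB.
have r2 : 0 < 2 * r by lra.
have YB4 := entries_bounded_diffs (ltW r2) YB2.
have r4 : 0 < 2 * (2 * r) by lra.
(* Three differentiations are made, the last for the continuity of the second derivative; they ask
   for [|t|] below [1 / (4 r)], [1 / (8 r)] and [1 / (16 r)]. *)
pose I := [set t : R | `|t| < (32 * r)^-1].
have I1 t : I t -> is_derive t 1 (matrix_sum Y) (matrix_sum (matrix_diffs Y) t).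
  rewrite /I /= -[_^-1]mul1r ltr_pdivlMr; last lra.
  by move=> tI; apply: (is_derive_matrix_sum r0 YB); have := normr_ge0 t; nra.
have I2 t : I t -> is_derive t 1 (matrix_sum (matrix_diffs Y))
    (matrix_sum (matrix_diffs (matrix_diffs Y)) t).
  rewrite /I /= -[_^-1]mul1r ltr_pdivlMr; last lra.
  by move=> tI; apply: (is_derive_matrix_sum r2 YB2); have := normr_ge0 t; nra.
have I3 t : I t -> is_derive t 1 (matrix_sum (matrix_diffs (matrix_diffs Y)))
    (matrix_sum (matrix_diffs (matrix_diffs (matrix_diffs Y))) t).
  rewrite /I /= -[_^-1]mul1r ltr_pdivlMr; last lra.
  by move=> tI; apply: (is_derive_matrix_sum r4 YB4); have := normr_ge0 t; nra.
have Inear t : I t -> \forall s \near t, I s.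
  move=> tI; have nc : {for t, continuous (fun s : R => `|s|)} := @norm_continuous _ _ t.
  by apply: (nc [set a | a < (32 * r)^-1]); exact: lt_nbhsl.
have E1 t : I t -> derive1 (matrix_sum Y) t = matrix_sum (matrix_diffs Y) t.
  by move=> tI; rewrite derive1E; have [_] := I1 t tI.
have E1near t : I t -> \forall s \near t,
    matrix_sum (matrix_diffs Y) s = derive1 (matrix_sum Y) s.
  by move=> /Inear; apply: filterS => s sI; rewrite E1.
have E2 t : I t -> derive1n 2 (matrix_sum Y) t =
    matrix_sum (matrix_diffs (matrix_diffs Y)) t.
  move=> tI; rewrite /derive1n /= derive1E -(near_eq_derive _ (E1near t tI)).
  by have [_] := I2 t tI.
split; last first.
  have I0 : I 0 by rewrite /I /= normr0 invr_gt0; lra.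
  by rewrite E1// matrix_sum0 /matrix_diffs scale1r.
move=> t t1 t2; have tI : I t by rewrite /I /= ltr_norml t1.
split.
- by have [] := I1 t tI.
- by apply: (near_eq_derivable (E1near t tI)); have [] := I2 t tI.
- have [d3 _] := I3 t tI.
  have c3 : {for t, continuous (matrix_sum (matrix_diffs (matrix_diffs Y)))}.
    exact/differentiable_continuous/derivable1_diffP.
  rewrite /prop_for /continuous_at E2//; apply: cvg_trans c3.
  by apply: near_eq_cvg; near=> s; rewrite E2//; near: s; exact: Inear.
Unshelve. all: by end_near. Qed.

End MatrixSeries.

(** * Solving the contact constraints degree by degree *)

Section LinkageCurve.
Context {R : realType} {n : nat}.
Local Notation V := 'M[R]_(n, 2).
Implicit Types (c v w : V) (e : 'I_n * 'I_n).

(** The polarization of the squared edge length, and half the differential of [contact_sq e] at [w]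
    along [w']. *)
Definition edge_form e w w' : R :=
  dot (row e.2 w - row e.1 w) (row e.2 w' - row e.1 w').

Lemma edge_formC e w w' : edge_form e w w' = edge_form e w' w.
Proof. exact: dotC. Qed.

Lemma edge_formDr e w w1 w2 :
  edge_form e w (w1 + w2) = edge_form e w w1 + edge_form e w w2.
Proof. by rewrite /edge_form !dotE !mxE; ring. Qed.

Lemma edge_formZr e w a w' : edge_form e w (a *: w') = a * edge_form e w w'.
Proof. by rewrite /edge_form !dotE !mxE; ring. Qed.

Lemma edge_form0r e w : edge_form e w 0 = 0.
Proof. by rewrite /edge_form !dotE !mxE; ring. Qed.

Lemma edge_form_sumr e w (I : Type) (r : seq I) (P : pred I) (a : I -> R) (b : I -> V) :
  edge_form e w (\sum_(i <- r | P i) a i *: b i) =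
  \sum_(i <- r | P i) a i * edge_form e w (b i).
Proof.
elim/big_ind2 : _ => [|x1 x2 y1 y2 <- <-|i _]; first exact: edge_form0r.
  exact: edge_formDr.
exact: edge_formZr.
Qed.

(** In the sup norm each coordinate difference is at most twice the norm; two coordinates give
    [2 * 2 * 2]. *)
Lemma edge_form_le e w w' : `|edge_form e w w'| <= 8 * (`|w| * `|w'|).
Proof.
have D k (z : V) : `|z e.2 k - z e.1 k| <= 2 * `|z|.
  apply: le_trans (ler_normB _ _) _.
  by have := norm_coord_le z e.2 k; have := norm_coord_le z e.1 k; lra.
rewrite /edge_form dotE !mxE; apply: le_trans (ler_normD _ _) _; rewrite !normrM.
have := ler_pM (normr_ge0 _) (normr_ge0 _) (D 0 w) (D 0 w').
have := ler_pM (normr_ge0 _) (normr_ge0 _) (D 1 w) (D 1 w').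
lra.
Qed.

Lemma diff_contact_sq e c w :
  'd (contact_sq e) c w = 2 * edge_form e c w :> R.
Proof.
rewrite /edge_form dotE !mxE.
exact: (diff_distance_sqr e.1 e.2 4 c w).
Qed.

Lemma regular_dual (E : rel 'I_n) c : regular E c ->
  exists a : 'I_n * 'I_n -> V, forall p q, p \in edges E -> q \in edges E ->
    2 * edge_form p c (a q) = (p == q)%:R.
Proof.
move=> [_ cfree].
have [a aP] := free_dual (enum_uniq (edges E)) cfree.
exists a => p q pE qE; rewrite -aP ?mem_enum// -diff_contact_sq diff_sum_delta.
by apply: eq_bigr => i _; apply: eq_bigr => k _; rewrite !mxE.
Qed.

Lemma linkage_edges (E : rel 'I_n) c : symmetric E -> irreflexive E ->
  linkage E c <-> forall e, e \in edges E -> edge_form e c c = 4.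
Proof.
move=> symE irrE; split=> [cE e|cE i j Eij].
  rewrite inE => /andP[_ Ee]; rewrite /edge_form -sqr_enorm -enormN opprB.
  by rewrite -/(dist c e.1 e.2) (cE _ _ Ee) expr2; lra.
have h (a b : 'I_n) : (a < b)%N -> E a b -> dist c a b = 2.
  move=> ab Eab; have abE : (a, b) \in edges E by rewrite inE /= ab.
  have := cE _ abE; rewrite /edge_form -sqr_enorm /= => h.
  rewrite /dist -opprB enormN; apply/eqP.
  by rewrite -(@eqrXn2 _ 2)// ?enorm_ge0// h expr2; apply/eqP; lra.
have [ij|ji|ij] := ltngtP i j; first exact: h.
  by rewrite /dist -opprB enormN; apply: h => //; rewrite symE.
by move: Eij; rewrite (val_inj ij) irrE.
Qed.

(* Each coefficient is determined by the lower ones: in degree [k + 1] the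
   constraint reads [2 <c, w_k> + sum_(i + j = k - 1) <w_i, w_j> = 0] for every
   edge, and regularity makes the linear part surjective. *)
Lemma linkage_coefficients (E : rel 'I_n) c v :
  regular E c -> (forall e, e \in edges E -> edge_form e c c = 4) ->
  (forall e, e \in edges E -> edge_form e c v = 0) ->
  exists (Y : nat -> V) (r : R),
    [/\ 0 < r, entries_bounded Y r, Y 0%N = c, Y 1%N = v &
      forall e, e \in edges E -> forall k,
        \sum_(i < k.+1) edge_form e (Y i) (Y (k - i)%N) =
        if k is 0%N then 4 else 0].
Proof.
move=> cR c4 cv; have [a aP] := regular_dual cR.
pose conv e (w : nat -> V) k := \sum_(i < k.+1) edge_form e (w i) (w (k - i)%N).
(* [w k] is the coefficient of degree [k + 1]: leaving [c] out makes the recursion a pure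
   convolution. The history has [k + 1] entries, so [(size h).-1] is [k] and the default of [nth] is
   never read. *)
have [w [w0 wS]] := strong_recursion v (fun h =>
  - \sum_(p in edges E) conv p (nth 0 h) (size h).-1 *: a p).
have {}wS k : w k.+1 = - \sum_(p in edges E) conv p w k *: a p.
  rewrite wS size_mkseq /=; congr (- _); apply: eq_bigr => p _; congr (_ *: _).
  apply: eq_bigr => i _; rewrite !nth_mkseq// ltnS ?leq_subr//.
(* The 8 is that of [edge_form_le]; the added 1 keeps [C] positive for a graph without edges. *)
pose C : R := 8 * \sum_(p in edges E) `|a p| + 1.
have C0 : 0 < C.
  have : 0 <= \sum_(p in edges E) `|a p| by apply: sumr_ge0.
  by rewrite /C; lra.
have wrec k : `|w k.+1| <= C * \sum_(i < k.+1) `|w i| * `|w (k - i)%N|.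
  set S := \sum_(i < k.+1) _; have S0 : 0 <= S.
    by apply: sumr_ge0 => i _; rewrite mulr_ge0.
  rewrite wS normrN; apply: le_trans (ler_norm_sum _ _ _) _.
  apply: (@le_trans _ _ (\sum_(p in edges E) 8 * S * `|a p|)).
    apply: ler_sum => p _; rewrite normrZ ler_wpM2r//.
    apply: le_trans (ler_norm_sum _ _ _) _; rewrite /S mulr_sumr.
    by apply: ler_sum => i _; exact: edge_form_le.
  by rewrite -mulr_sumr /C; lra.
have [r [r0 [M wM]]] := quadratic_recursion_growth C0 (fun k => normr_ge0 (w k)) wrec.
pose Y k := if k is k'.+1 then w k' else c.
exists Y, r; split=> //.
(* The shift of index from [w] to [Y] costs a factor [1 / r], and the norm of [c] covers degree
   0. *)
- move=> i k; exists (`|c| + M / r) => l.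
  have M0 : 0 <= M.
    apply: le_trans (normr_ge0 _) _.
    by have := wM 0%N; rewrite expr0 mulr1; apply.
  have Mr : 0 <= M / r by rewrite divr_ge0// ltW.
  apply: le_trans (norm_coord_le _ _ _) _; case: l => [|l].
    by rewrite expr0 mulr1 lerDl.
  have := wM l; rewrite normr_id => /le_trans; apply.
  rewrite mulrDl exprS [M / r * _]mulrA divfK ?gt_eqF// lerDr.
  by rewrite mulr_ge0// -exprS exprn_ge0// ltW.
- move=> e eE [|[|k]].
  + by rewrite big_ord1; exact: c4.
  + rewrite big_ord_recl big_ord1 /= /Y /= w0 [X in _ + X]edge_formC.
    by rewrite cv// addr0.
  (* Both end terms equal [edge_form e c (w k.+1)]; by duality they add up to [- conv e w k], which
     cancels the middle of the sum. *)
  + rewrite big_ord_recl big_ord_recr /=.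
    have -> : \sum_(i < k.+1) edge_form e (Y (bump 0 i)) (Y (k.+2 - bump 0 i)%N) =
        conv e w k.
      apply: eq_bigr => i _; rewrite /bump /= add1n subSS.
      by have ik : (i <= k)%N; [rewrite -ltnS | rewrite subSn].
    rewrite add0n /bump /= add1n subnn [X in _ + (_ + X)]edge_formC /= wS.
    rewrite -scaleN1r edge_formZr edge_form_sumr (bigD1 e)//=.
    rewrite big1 ?addr0 => [|p /andP[pE pe]].
      have := aP e e eE eE; rewrite eqxx /= => h.
      by have -> : edge_form e c (a e) = 2^-1; lra.
    have /eqP := aP e p eE pE; rewrite [e == p]eq_sym (negbTE pe) mulf_eq0 pnatr_eq0 /=.
    by move=> /eqP ->; rewrite mulr0.
Qed.

Lemma linkage_curve (E : rel 'I_n) c v :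
  symmetric E -> irreflexive E -> regular E c -> Roll E c v ->
  exists (eps : R) (gam : R -> V),
    [/\ 0 < eps, C2_on (- eps) eps gam,
      forall t, - eps < t -> t < eps -> linkage E (gam t),
      gam 0 = c & derive1 gam 0 = v].
Proof.
move=> symE irrE cR cv; have [cE _] := cR.
have c4 := iffLR (linkage_edges c symE irrE) cE.
have cv0 e : e \in edges E -> edge_form e c v = 0.
  move=> eE; have := eE; rewrite inE => /andP[_ Ee].
  have := cv _ _ Ee; rewrite /unit_dir dotC dotZr dotC => /eqP.
  rewrite mulf_eq0 invr_eq0 => /orP[/eqP e0|/eqP//].
  by have := c4 e eE; rewrite /edge_form -sqr_enorm e0 expr0n /=; lra.
have [Y [r [r0 YB Y0 Y1 Yconv]]] := linkage_coefficients cR c4 cv0.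
have [YC2 YD] := matrix_sum_C2 r0 YB.
exists (32 * r)^-1, (matrix_sum Y); split=> //; last 2 first.
- by rewrite matrix_sum0.
- by rewrite YD.
- by rewrite invr_gt0; lra.
move=> t t1 t2; apply/linkage_edges => // e eE.
have tr : `|t| * (32 * r) < 1.
  by rewrite -ltr_pdivlMr ?mul1r ?ltr_norml ?t1//; lra.
pose D k l := Y l e.2 k - Y l e.1 k.
have DB k : geometric_bound (D k) r.
  have [M1 h1] := YB e.2 k; have [M2 h2] := YB e.1 k; exists (M1 + M2) => l.
  by apply: le_trans (ler_normB _ _) _; rewrite mulrDl lerD.
have DE k : power_sum (D k) t = matrix_sum Y t e.2 k - matrix_sum Y t e.1 k.
  have yc i : cvgn (pseries (fun l => Y l i k) t).
    apply: (cvg_pseries_geometric (ltW r0) (YB i k)).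
    by have := normr_ge0 t; nra.
  rewrite !mxE /power_sum -limB//; congr (lim (_ @ \oo)); apply/funext => N.
  rewrite -[RHS]/(pseries _ t N - pseries _ t N) /pseries /series /= -sumrB.
  by apply: eq_bigr => i _; rewrite mulrBl.
have rowE k : (row e.2 (matrix_sum Y t) - row e.1 (matrix_sum Y t)) 0 k =
    power_sum (D k) t by rewrite DE !mxE.
rewrite /edge_form dotE !rowE -!expr2.
apply: (power_sum_sqrD r0 (DB 0) (DB 1)); last by have := normr_ge0 t; nra.
move=> k; rewrite -(Yconv e eE k); apply: eq_bigr => i _.
by rewrite /edge_form dotE !mxE.
Qed.

End LinkageCurve.

(** [near_join] upgrades the equality near 0 to one near each nearby [t], so that the derivatives
    agree on a neighbourhood and can be differentiated again. *)
Lemma near_eq_derive1_cst (R : realType) (f g : R -> R) (k : R) :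
  (\forall t \near (0 : R), f t = g t + k) ->
  (\forall t \near (0 : R), derivable g t 1) ->
  \forall t \near (0 : R), derivable f t 1 /\ derive1 g t = derive1 f t.
Proof.
move=> /near_join fg dg; near=> t.
have dgt : derivable g t 1 by near: t.
have fgt : \forall s \near t, (g + cst k) s = f s.
  have : \forall s \near t, f s = g s + k by near: t.
  by apply: filterS => s ->.
have dgk := is_deriveD (derivableP dgt) (is_derive_cst k t 1).
have [df] := near_eq_is_derive fgt dgk.
by rewrite !derive1E addr0 => <-.
Unshelve. all: by end_near. Qed.

Lemma diff_gradient (R : realType) m n (f : 'M[R]_(m, n) -> R) c a :
  'd f c a = \sum_i \sum_k a i k * gradient f c i k :> R.
Proof.
rewrite diff_sum_delta; apply: eq_bigr => i _.
by apply: eq_bigr => k _; rewrite mxE.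
Qed.

Lemma diff_multiplier (R : realType) m n (I : finType) (A : {set I})
    (f : 'M[R]_(m, n) -> R) (g : I -> 'M[R]_(m, n) -> R) (lam : I -> R) c a :
  gradient f c = \sum_(p in A) lam p *: gradient (g p) c ->
  'd f c a = \sum_(p in A) lam p * ('d (g p) c a : R) :> R.
Proof.
move=> fE; rewrite diff_gradient fE.
under [RHS]eq_bigr do rewrite diff_gradient.
elim/big_rec2: _ => [|p y z _ <-].
  by apply: big1 => i _; apply: big1 => k _; rewrite mxE mulr0.
rewrite mulr_sumr; apply/esym; under eq_bigr do rewrite mulr_sumr.
by apply: sum2D => i k; rewrite !mxE; ring.
Qed.

Section SmoothLengths.
Context {R : realType} {n : nat}.
Implicit Types (c : 'M[R]_(n, 2)) (s : seq 'I_n).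

Lemma C2_at_contact (p : 'I_n * 'I_n) c :
  0 < enorm (row p.2 c - row p.1 c) -> C2_at (contact p) c.
Proof.
move=> pc; have h := C2_atD (C2_at_distance (or_intror pc)) (C2_at_cst (- 2) c).
exact: h.
Qed.

Lemma C2_at_Per_ext s c : packing c -> C2_at (Per_ext s) c.
Proof.
move=> cP.
have h := C2_atD (C2_at_sum (cyclic_edges s)
  (F := fun e d => enorm (row e.2 d - row e.1 d)) (c := c) _) (C2_at_cst (2 * pi) c).
apply: h => -[p q]; apply: C2_at_distance => /=.
have [->|pq] := eqVneq p q; [by left | right].
by have := cP _ _ pq; rewrite /dist -opprB enormN; apply: lt_le_trans.
Qed.

End SmoothLengths.

Theorem theorem5p1 (R : realType) (n : nat)
    (E : rel 'I_n) (symE : symmetric E) (irrE : irreflexive E)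
    (c0 : 'M[R]_(n, 2)) (c0_stable : hull_stable c0)
    (c0_contact : contact_class E c0) (c0_regular : regular E c0)
    (s : seq 'I_n) (s_cycle : hull_cycle c0 s)
    (c : 'M[R]_(n, 2)) (c_regular : rel_interior_regular E c0 c)
    (c_critical : class_critical E s c)
    (lam : 'I_n * 'I_n -> R)
    (lam_multiplier : gradient (Per_ext s) c =
       \sum_(p in edges E) lam p *: gradient (contact p) c) :
  (forall v : 'M[R]_(n, 2), Roll E c v ->
   forall (eps : R) (gam : R -> 'M[R]_(n, 2)),
   C2_curve_through (fixed_class E c0) c v eps gam ->
     (\forall t \near (0 : R), derivable (fun r : R => Per (gam r)) t 1) /\
     is_derive (0 : R) 1 (derive1 (fun r : R => Per (gam r)))
       (D2 (Per_ext s) c v v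
        - \sum_(p in edges E) lam p * D2 (contact p) c v v)) /\
  (forall v : 'M[R]_(n, 2), Roll E c v ->
   exists (eps : R) (gam : R -> 'M[R]_(n, 2)),
     C2_curve_through (fixed_class E c0) c v eps gam).

Proof.
have [c0P _] := c0_stable.
have [k PerE] := Per_hull_class c0P s_cycle.
have [[[cP _] [_ cE]] cR [U0 [U0open U0c U0E U0hull]]] := c_regular.
have [cL _] := cR.
split=> [v _ eps gam [eps0 gamC2 gamX g0 g1]|v vR].
  have near0 : \forall t \near (0 : R), - eps < t /\ t < eps.
    by near=> t; split; near: t; [apply: lt_nbhsr | apply: lt_nbhsl];
      rewrite ?oppr_lt0.
  have dgam : \forall t \near (0 : R), derivable gam t 1.
    by apply: filterS near0 => t [t1 t2]; have [] := gamC2 t t1 t2.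
  have [_ d2gam _] := gamC2 0 ltac:(by rewrite oppr_lt0) eps0.
  pose a : 'M[R]_(n, 2) := 'D_1 (derive1 gam) 0.
  have accel : is_derive (0 : R) 1 (derive1 gam) a := derivableP d2gam.
  have [dPer d2Per] := C2_at_curve (C2_at_Per_ext s cP) g0 g1 dgam accel.
  have PerN : \forall t \near (0 : R),
      (fun r => Per (gam r)) t = (Per_ext s \o gam) t + k.
    by apply: filterS near0 => t [t1 t2]; have [/PerE] := gamX t t1 t2.
  have PerD := near_eq_derive1_cst PerN dPer.
  split; first by apply: filterS PerD => t [].
  have contactD p : p \in edges E ->
      D2 (contact p) c v v = - ('d (contact p) c a : R).
    move=> pE; have := pE; rewrite inE => /andP[_ Ep].
    have pc : enorm (row p.2 c - row p.1 c) = 2.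
      by rewrite -enormN opprB; exact: (cL _ _ Ep).
    have pC2 : C2_at (contact p) c by apply: C2_at_contact; rewrite pc.
    have [dp [_ d2p]] := C2_at_curve pC2 g0 g1 dgam accel.
    have p12 : p.1 != p.2 by apply: contraTneq Ep => ->; rewrite irrE.
    have p0 : \forall t \near (0 : R), cst 0 t = (contact p \o gam) t + 0.
      apply: filterS near0 => t [t1 t2]; have [_ [_ tE]] := gamX t t1 t2.
      rewrite /= addr0 /contact -enormN opprB -/(dist (gam t) p.1 p.2).
      by rewrite (iffRL (tE p.1 p.2 p12) Ep) subrr.
    have p0' : \forall t \near (0 : R), cst 0 t = derive1 (contact p \o gam) t.
      apply: filterS (near_eq_derive1_cst p0 dp) => t [_ ->].
      by rewrite derive1_cst.
    have [_ d0] := near_eq_is_derive p0' (is_derive_cst (0 : R) (0 : R) (1 : R)).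
    by apply/eqP; rewrite -addr_eq0 -d2p d0.
  have -> : D2 (Per_ext s) c v v - \sum_(p in edges E) lam p * D2 (contact p) c v v =
      D2 (Per_ext s) c v v + 'd (Per_ext s) c a.
    congr (_ + _); rewrite (diff_multiplier a lam_multiplier) -sumrN.
    by apply: eq_bigr => p pE; rewrite contactD// mulrN opprK.
  apply: near_eq_is_derive d2Per.
  by apply: filterS PerD => t [].
have [eps [gam [eps0 gamC2 gamL g0 g1]]] := linkage_curve symE irrE cR vR.
have [dgam _ _] := gamC2 0 ltac:(by rewrite oppr_lt0) eps0.
have cgam : {for 0, continuous gam}.
  exact/differentiable_continuous/derivable1_diffP.
(* In [U0] non-edges of a linkage point stay beyond distance 2, so the point is a packing, and
   packings in [U0] have the prescribed hull. Shrinking the interval until the curve stays in [U0]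
   therefore puts it in the class. *)
have : \forall t \near (0 : R), U0 (gam t).
  by apply: cgam; rewrite g0; exact: open_nbhs_nbhs.
move=> /nbhs_ballP[e /= e0 eU].
exists (Num.min eps e), gam; split; [| | | exact: g0 | exact: g1].
- by rewrite lt_min eps0.
- move=> t t1 t2; apply: gamC2.
    by apply: le_lt_trans t1; rewrite lerN2 ge_min lexx.
  by apply: lt_le_trans t2 _; rewrite ge_min lexx.
- move=> t t1 t2; have tU : U0 (gam t).
    apply: eU; rewrite /ball /= sub0r normrN ltr_norml; apply/andP; split.
      by apply: le_lt_trans t1; rewrite lerN2 ge_min lexx orbT.
    by apply: lt_le_trans t2 _; rewrite ge_min lexx orbT.
  have tL : linkage E (gam t).
    apply: gamL; first by apply: le_lt_trans t1; rewrite lerN2 ge_min lexx.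
    by apply: lt_le_trans t2 _; rewrite ge_min lexx.
  have tP : packing (gam t).
    move=> i j ij; have [/tL -> //|nE] := boolP (E i j).
    by apply/ltW/U0E.
  split; first exact: U0hull.
  split=> // i j ij; split=> [d2|/tL //].
  apply/negPn/negP => nE; have := U0E _ tU tL i j ij nE.
  by rewrite d2 ltxx.
Unshelve. all: by end_near. Qed.
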